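(* Let $q\ge 3$ be a prime number. Let $m,n\in\mathbb{Z}$ and assume that $$p:=\sum_{i=0}^{q-1}m^i n^{q-1-i}=\Phi_q(n/m)\,m^{q-1}$$ is a prime number other than $q$. Then the following are equivalent. (1) $\left(\frac{q}{p}\right)_q=1$. (2) $\mathrm{Li}_{1-q}\left(\frac{n}{m}\right)\in q^2\mathbb{Z}_{(q)}$.
   Context: $\Phi_q(x)=\sum_{i=0}^{q-1}x^i$ is the $q$-th cyclotomic polynomial. $\mathbb{Z}_{(q)}$ denotes the localization of $\mathbb{Z}$ at the prime ideal $q\mathbb{Z}$. For a prime $p\equiv 1 \bmod q$ and $a\in\mathbb{Z}$, the rational $q$-th power residue symbol is defined by $\left(\frac{a}{p}\right)_q=1$ if there exists $b\in\mathbb{Z}$ with $a\equiv b^q \bmod p$, and $\left(\frac{a}{p}\right)_q=-1$ otherwise. The polylogarithm of negative index is the rational function $$\mathrm{Li}_{1-q}(x):=\left(x\frac{d}{dx}\right)^{q-1}\frac{x}{1-x}\in\mathbb{Q}(x).$$ The assumption that $p$ is a prime other than $q$ implies $m\ne 0$, $m-n\not\equiv 0\bmod q$ and $p\equiv 1\bmod q$, so that the symbol $\left(\frac{q}{p}\right)_q$ and the value $\mathrm{Li}_{1-q}(n/m)\in\mathbb{Q}$ are defined. *)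

(* Defs.v *)
From mathcomp Require Import all_boot all_order all_algebra.
From mathcomp Require Import generic_quotient boolp.
From mathcomp Require Import ring.

Set Implicit Arguments.
Unset Strict Implicit.
Unset Printing Implicit Defensive.

Import Order.TTheory GRing.Theory Num.Theory.
Local Open Scope ring_scope.

Notation "x %:F" := (@FracField.tofrac _ x) : ring_scope.

(* The definition makes sense for every nat p; it is the q-th power residue
   symbol when p is a prime congruent to 1 modulo q. *)
Definition power_residue_symbol (q : nat) (a : int) (p : nat) : int :=
  if `[< exists b : int, (a = b ^+ q %[mod p%:Z])%Z >] then 1 else -1.

Definition Zloc (q : nat) (x : rat) : Prop :=
  exists a b : int, ~~ (q%:Z %| b)%Z /\ x = a%:~R / b%:~R.

Section RationalFunctions.

Variable F : fieldType.
Implicit Types (f : {fraction {poly F}}) (n d : {poly F}).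

Definition fnum f : {poly F} := \n_(repr f).
Definition fden f : {poly F} := \d_(repr f).

(* Quotient rule on a chosen representative; fderivE shows that every
   representative gives the same result. *)
Definition fderiv f : {fraction {poly F}} :=
  ((fnum f)^`() * fden f - fnum f * (fden f)^`())%:F / (fden f ^+ 2)%:F.

(* Value at a of f written in lowest terms; at a pole of f the value is 0,
   by the convention x / 0 = 0. *)
Definition fhorner f (a : F) : F :=
  let g := gcdp (fnum f) (fden f) in
  (fnum f %/ g).[a] / (fden f %/ g).[a].

Lemma fden_neq0 f : fden f != 0.
Proof. exact: denom_ratioP. Qed.

Lemma fracE f : f = (fnum f)%:F / (fden f)%:F.
Proof.
have := fden_neq0 f; rewrite /fnum /fden -{2}[f]reprK.
elim/quotW: f => r; move: (repr _) => {}r r0.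
apply: (canRL (mulfK _)); first by rewrite tofrac_eq0.
rewrite /GRing.mul /= !piE; apply/eqmodP.
by rewrite /= FracField.equivfE /FracField.mulf !numden_Ratio ?mulr1 ?oner_eq0 // mulrC.
Qed.

Lemma fnum_fden n d : d != 0 -> fnum (n%:F / d%:F) * d = n * fden (n%:F / d%:F).
Proof.
move=> d0; apply/eqP; rewrite -tofrac_eq !tofracM -eqr_div ?tofrac_eq0 //.
  by rewrite -fracE.
exact: fden_neq0.
Qed.

Lemma fderivE n d : d != 0 ->
  fderiv (n%:F / d%:F) = (n^`() * d - n * d^`())%:F / (d ^+ 2)%:F.
Proof.
move=> d0; have := fnum_fden n d0; have := fden_neq0 (n%:F / d%:F).
rewrite /fderiv; move: (fnum _) (fden _) => n1 d1 d10 e.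
have e' : n1^`() * d = n^`() * d1 + n * d1^`() - n1 * d^`().
  by have := congr1 deriv e; rewrite !derivM => <-; rewrite addrK.
apply/eqP; rewrite eqr_div ?tofrac_eq0 ?expf_neq0 // -!tofracM tofrac_eq.
apply/eqP.
have -> : (n1^`() * d1 - n1 * d1^`()) * d ^+ 2
        = (n1^`() * d) * d1 * d - (n1 * d) * d1^`() * d by ring.
rewrite e' e.
have -> : (n^`() * d1 + n * d1^`() - n1 * d^`()) * d1 * d - n * d1 * d1^`() * d
        = n^`() * d1 ^+ 2 * d - (n1 * d) * d^`() * d1 by ring.
by rewrite e; ring.
Qed.

Lemma fhornerE n d a : d.[a] != 0 -> fhorner (n%:F / d%:F) a = n.[a] / d.[a].
Proof.
move=> da; have d0 : d != 0 by apply: contraNneq da => ->; rewrite horner0.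
have := fnum_fden n d0; have := fden_neq0 (n%:F / d%:F).
rewrite /fhorner /=; move: (fnum _) (fden _) => n1 d1 d10 e.
set g := gcdp n1 d1; have g0 : g != 0 by rewrite gcdp_eq0 negb_and d10 orbT.
have n1E : n1 = n1 %/ g * g by rewrite divpK ?dvdp_gcdl.
have d1E : d1 = d1 %/ g * g by rewrite divpK ?dvdp_gcdr.
have cop : coprimep (d1 %/ g) (n1 %/ g).
  by rewrite coprimep_sym coprimep_div_gcd // d10 orbT.
have {}e : n1 %/ g * d = n * (d1 %/ g).
  by apply: (mulIf g0); rewrite mulrAC -n1E e {1}d1E mulrA.
have dv : d1 %/ g %| d.
  by rewrite -(Gauss_dvdpr _ cop) e dvdp_mulIr.
have d2a : (d1 %/ g).[a] != 0.
  by apply: contraNneq da => d2a; move: dv => /dvdpP[c ->]; rewrite hornerM d2a mulr0.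
by apply/eqP; rewrite eqr_div // -!hornerM e.
Qed.

Definition theta f : {fraction {poly F}} := 'X%:F * fderiv f.

(* neg_polylog k is Li_{-k}. *)
Definition neg_polylog (k : nat) : {fraction {poly F}} :=
  iter k theta ('X%:F / (1 - 'X)%:F).

End RationalFunctions.

(* Main.v *)
From HB Require Import structures.
Require Import Defs.
From mathcomp Require Import all_boot all_order all_algebra qpoly cyclic.
From mathcomp Require Import boolp zify ring.

Set Implicit Arguments.
Unset Strict Implicit.
Unset Printing Implicit Defensive.

Import Order.TTheory GRing.Theory Num.Theory.
Local Open Scope ring_scope.

(** Let [w] be a primitive [q]-th root of unity, [lam = w - 1], and let [c] be the
    index of [q] modulo [p], so that [q] is a [q]-th power modulo [p] if and only
    if [q] divides [c].  Two descriptions of the [q]-th power [g] of the Gauss sum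
    of order [q] modulo [p] are compared.

    Modulo [lam ^ (q + 1)], the number [- g] is [1 - c * lam ^ q]
    ([gauss_sum_rcong]): the Gauss sum is [-1 + lam * h], its [q]-th power only
    sees [h - h ^ q] at this precision, and the Frobenius map acts on the
    additive character in [h] by multiplying its argument by [q], which shifts
    indices by [c].

    On the other hand [p] is the norm of [m - n * w], so the primes above [p] are
    principal, and [g] is the product of [p] and [q - 2] Jacobi sums.  A Jacobi sum
    reduces, at each prime above [p], to a sum over the prime field of a monomial
    in [x] and [1 - x], which vanishes if the degree is small
    ([evz_jacobi_poly_eq0]).  This is half of Stickelberger's theorem: it gives
    the equality of [g * \prod_t (m - n * w ^ (1 / t)) ^ t] and [p ^ q] up to a
    factor [u] in [Z[w]]; comparing absolute values, [u] times its conjugate is 1,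
    and then [u] is, up to sign, a power of [w] ([unit_circle_geom]).

    The two descriptions are compared by a logarithm.  Represent cyclotomic
    integers by polynomials [P] and take the [q]-th derivative at [v = 0] of
    [log (P (exp v))], an element of [Z / q ^ 2] when [P (1)] is prime to [q].
    This is additive in [P] ([logderM]), and it does not change when [P] is
    changed by a multiple of [1 + X + ... + X ^ (q - 1)] ([logder_geom]), so that
    it is defined on cyclotomic integers.  It kills constants and [X], sends
    [1 - c * lam ^ q] to [- c * q!], multiplies by [s ^ q] when [w] is replaced by
    [w ^ s], and sends [m - n * X] to [- Li_{1-q} (n / m)], since polylogarithms
    are the Euler derivatives of [log (1 - x)].  The product formula for [g] thus
    becomes [c * q! = kappa * (- Li_{1-q} (n / m))] modulo [q ^ 2], where
    [kappa = \sum_t t * t ^ (- q)] is congruent to -1 modulo [q]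
    ([local_criterion]). *)

(** * Congruences and prime fields *)

Lemma expr_eq_mod (R : pzRingType) (x : R) k i j :
  x ^+ k = 1 -> i = j %[mod k] -> x ^+ i = x ^+ j.
Proof. by move=> xk ij; rewrite -(expr_mod i xk) ij expr_mod. Qed.

Lemma expr_sum0 (R : pzRingType) (x : R) k : \sum_(i < k) x ^+ i = 0 -> x ^+ k = 1.
Proof. by move=> s0; apply/eqP; rewrite -subr_eq0 subrX1 s0 mulr0. Qed.

Lemma big_Fp (T : Type) (idx : T) (op : Monoid.com_law idx) p (F : nat -> T) :
  prime p -> \big[op/idx]_(x : 'F_p) F x = \big[op/idx]_(i < p) F i.
Proof. by move=> p_pr; rewrite -(big_mkord xpredT F) Fp_cast // big_mkord. Qed.

Lemma Fp_natr_eq0 p a : prime p -> (a%:R == 0 :> 'F_p) = (p %| a)%N.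
Proof. by move=> p_pr; rewrite (dvdn_pcharf (pchar_Fp p_pr)). Qed.

Lemma expr_FpM (R : pzRingType) (x : R) p (a b : 'F_p) :
  prime p -> x ^+ p = 1 -> x ^+ (a * b : 'F_p)%R = x ^+ ((a : nat) * b)%N.
Proof. by move=> p_pr xp; rewrite /= [X in (_ %% X)%N]Fp_cast // expr_mod. Qed.

Lemma expr_FpD (R : pzRingType) (x : R) p (a b : 'F_p) :
  prime p -> x ^+ p = 1 -> x ^+ (a + b : 'F_p)%R = x ^+ a * x ^+ b.
Proof. by move=> p_pr xp; rewrite /= [X in (_ %% X)%N]Fp_cast // expr_mod // exprD. Qed.

Lemma expr_Fp_nat (R : pzRingType) (x : R) p a :
  prime p -> x ^+ p = 1 -> x ^+ (a%:R : 'F_p)%R = x ^+ a.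
Proof. by move=> p_pr xp; rewrite val_Fp_nat // expr_mod. Qed.

Lemma sum_exprX0 (R : pzRingType) (x : R) q a : prime q ->
  \sum_(i < q) x ^+ i = 0 -> ~~ (q %| a)%N -> \sum_(i < q) (x ^+ a) ^+ i = 0.
Proof.
move=> q_pr x_sum qa; have xq := expr_sum0 x_sum.
have a0 : a%:R != 0 :> 'F_q by rewrite Fp_natr_eq0.
rewrite -(big_Fp _ (fun i => (x ^+ a) ^+ i)) // -[RHS]x_sum.
rewrite -(big_Fp _ (fun i => x ^+ i)) // [RHS](reindex_inj (mulfI a0)) /=.
by apply: eq_bigr => i _; rewrite expr_FpM // exprM expr_Fp_nat // -!exprM.
Qed.

Lemma sum_expr_bin (R : comNzRingType) (x : R) n :
  \sum_(i < n) (x + 1) ^+ i = \sum_(k < n) 'C(n, k.+1)%:R * x ^+ k.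
Proof.
elim: n => [|n IHn]; first by rewrite !big_ord0.
rewrite big_ord_recr /= IHn exprD1n.
under [RHS]eq_bigr => k _ do rewrite binS natrD mulrDl.
rewrite big_split /= [in RHS]big_ord_recr /= bin_small // mul0r addr0.
by congr (_ + _); apply: eq_bigr => k _; rewrite mulr_natl.
Qed.

Lemma big_Fp_neq0 (T : Type) (idx : T) (op : Monoid.com_law idx) p (F : nat -> T) :
  prime p -> \big[op/idx]_(x : 'F_p | x != 0) F x = \big[op/idx]_(1 <= i < p) F i.
Proof.
move=> p_pr; rewrite big_mkcond.
pose F0 i := if i != 0%N then F i else idx.
rewrite (big_Fp _ F0) // -(big_mkord xpredT F0).
rewrite big_ltn ?prime_gt0 //= Monoid.mul1m.
by rewrite big_nat [RHS]big_nat; apply: eq_bigr => -[|i].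
Qed.

Section Divisibility.

Variable R : comNzRingType.
Implicit Types d x y : R.

Definition rdvd d x := exists y, x = d * y.

Lemma rdvd0 d : rdvd d 0. Proof. by exists 0; rewrite mulr0. Qed.

Lemma rdvdD d x y : rdvd d x -> rdvd d y -> rdvd d (x + y).
Proof. by move=> [a ->] [b ->]; exists (a + b); rewrite mulrDr. Qed.

Lemma rdvd_mulr d x y : rdvd d x -> rdvd d (x * y).
Proof. by move=> [a ->]; exists (a * y); rewrite mulrA. Qed.

Lemma rdvd_mull d x y : rdvd d x -> rdvd d (y * x).
Proof. by rewrite mulrC; apply: rdvd_mulr. Qed.

Lemma rdvdN d x : rdvd d x -> rdvd d (- x).
Proof. by rewrite -mulN1r; apply: rdvd_mull. Qed.

Lemma rdvd_sum d I (r : seq I) (P : pred I) (F : I -> R) :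
  (forall i, P i -> rdvd d (F i)) -> rdvd d (\sum_(i <- r | P i) F i).
Proof. by move=> dF; elim/big_rec: _ => [|i x /dF]; [apply: rdvd0|apply: rdvdD]. Qed.

Lemma rdvd_trans d x y : rdvd d x -> rdvd x y -> rdvd d y.
Proof. by move=> dx [a ->]; apply: rdvd_mulr. Qed.

Lemma rdvd_exp x i j : (i <= j)%N -> rdvd (x ^+ i) (x ^+ j).
Proof. by move=> ij; exists (x ^+ (j - i)); rewrite -exprD subnKC. Qed.

Definition rcong d x y := rdvd d (x - y).

Lemma rcong_refl d x : rcong d x x.
Proof. by rewrite /rcong subrr; apply: rdvd0. Qed.

Lemma rcong_sym d x y : rcong d x y -> rcong d y x.
Proof. by move=> xy; rewrite /rcong -opprB; apply: rdvdN. Qed.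

Lemma rcong_trans d x y t : rcong d x y -> rcong d y t -> rcong d x t.
Proof. by move=> xy yt; rewrite /rcong -(subrKA y); apply: rdvdD. Qed.

Lemma rcongM d x1 x2 y1 y2 :
  rcong d x1 x2 -> rcong d y1 y2 -> rcong d (x1 * y1) (x2 * y2).
Proof.
move=> hx hy; rewrite /rcong.
have -> : x1 * y1 - x2 * y2 = (x1 - x2) * y1 + x2 * (y1 - y2) by ring.
by apply: rdvdD; [apply: rdvd_mulr|apply: rdvd_mull].
Qed.

Lemma rcongX d x y k : rcong d x y -> rcong d (x ^+ k) (y ^+ k).
Proof.
move=> xy; elim: k => [|k IHk]; first exact: rcong_refl.
by rewrite !exprS; apply: rcongM.
Qed.

Lemma rcong_sum d I (r : seq I) (P : pred I) (F G : I -> R) :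
  (forall i, P i -> rcong d (F i) (G i)) ->
  rcong d (\sum_(i <- r | P i) F i) (\sum_(i <- r | P i) G i).
Proof. by move=> FG; rewrite /rcong -sumrB; apply: rdvd_sum. Qed.

Lemma rcong_nat q a b : a = b %[mod q] -> rcong q%:R (a%:R : R) b%:R.
Proof.
move=> ab; have e c : rcong q%:R (c%:R : R) (c %% q)%:R.
  exists (c %/ q)%:R.
  by rewrite {1}(divn_eq c q) natrD natrM mulrC addrK.
by apply: rcong_trans (e a) _; rewrite ab; apply: rcong_sym.
Qed.

End Divisibility.

Section Frobenius.

Variables (R : comNzRingType) (q : nat) (q_prime : prime q).

Lemma rdvd_bin k : (0 < k < q)%N -> rdvd q%:R ('C(q, k)%:R : R).
Proof.
move=> kq; have /dvdnP[b ->] := prime_dvd_bin q_prime kq.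
by exists b%:R; rewrite natrM mulrC.
Qed.

Lemma frobeniusD (x y : R) : rcong q%:R ((x + y) ^+ q) (x ^+ q + y ^+ q).
Proof.
have q0 := prime_gt0 q_prime.
rewrite /rcong exprDn -(big_mkord xpredT (fun i => x ^+ (q - i) * y ^+ i *+ 'C(q, i))).
rewrite big_nat_recr //= big_ltn // subn0 subnn bin0 binn expr0 !mulr1n mul1r mulr1.
have -> : forall a b c : R, a + b + c - (a + c) = b by move=> *; ring.
rewrite big_nat; apply: rdvd_sum => k kq; rewrite -[_ *+ 'C(q, k)]mulr_natr.
by apply: rdvd_mull; apply: rdvd_bin.
Qed.

Lemma frobenius_sum I (r : seq I) (P : pred I) (F : I -> R) :
  rcong q%:R ((\sum_(i <- r | P i) F i) ^+ q) (\sum_(i <- r | P i) F i ^+ q).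
Proof.
elim/big_rec2: _ => [|i x y _ yx].
  by rewrite expr0n eqn0Ngt prime_gt0 //; apply: rcong_refl.
apply: rcong_trans (frobeniusD _ _) _; rewrite /rcong.
by rewrite opprD addrACA subrr add0r.
Qed.

Lemma fermat_rcong k : rcong (q%:R : R) (k%:R ^+ q) k%:R.
Proof. by rewrite -natrX; apply: rcong_nat; apply: fermat_little. Qed.

End Frobenius.

Lemma Fp_expf_pred p (x : 'F_p) : prime p -> x != 0 -> x ^+ p.-1 = 1.
Proof.
move=> p_prime x0; apply: (mulfI x0); rewrite -exprS prednK ?prime_gt0 // mulr1.
have [y] := fermat_rcong 'F_p p_prime x.
by rewrite pchar_Fp_0 // mul0r natr_Zp => /eqP; rewrite subr_eq0 => /eqP.
Qed.

(** * Gauss and Jacobi sums *)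

Section GaussSums.

Variables (R : comNzRingType) (p q : nat).
Hypotheses (p_prime : prime p) (q_prime : prime q) (q_odd : odd q).
Hypothesis tfree : forall n (x : R), x *+ n.+1 = 0 -> x = 0.

Variable z : R.
Hypothesis z_sum : \sum_(s < p) z ^+ s = 0.

Variable ind : 'F_p -> nat.
Hypothesis indM : forall x y, x != 0 -> y != 0 ->
  ind (x * y) = (ind x + ind y)%N %[mod q].
Hypothesis ind_onto : exists2 v, v != 0 & ind v = 1%N %[mod q].

Let z_p : z ^+ p = 1 := expr_sum0 z_sum.

Definition addchar (x : 'F_p) : R := z ^+ x.

Definition mulchar (w : R) (x : 'F_p) : R := if x == 0 then 0 else w ^+ ind x.

Definition gauss_sum (w : R) : R := \sum_x mulchar w x * addchar x.

Definition jacobi_sum (w1 w2 : R) : R := \sum_x mulchar w1 x * mulchar w2 (1 - x).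

Lemma addcharD x y : addchar (x + y) = addchar x * addchar y.
Proof. by rewrite /addchar /= {3}Fp_cast // expr_mod // exprD. Qed.

Lemma addchar0 : addchar 0 = 1.
Proof. by []. Qed.

Lemma sum_addchar c : \sum_x addchar (c * x) = if c == 0 then p%:R else 0.
Proof.
case: eqP => [->|/eqP c0].
  under eq_bigr => x _ do rewrite mul0r addchar0.
  by rewrite sumr_const card_Fp.
have -> : \sum_x addchar (c * x) = \sum_x addchar x.
  by rewrite [RHS](reindex_inj (mulfI c0)).
by rewrite /addchar -(big_mkord xpredT (fun s => z ^+ s)) Fp_cast // big_mkord.
Qed.

Lemma sum_addchar_neq0 c :
  \sum_(x | x != 0) addchar (c * x) = (if c == 0 then p%:R else 0) - 1.
Proof.
rewrite -sum_addchar [in RHS](bigD1 (0 : 'F_p)) //= mulr0 addchar0.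
by rewrite addrC addrK.
Qed.

Lemma mulcharM w x y : w ^+ q = 1 -> mulchar w (x * y) = mulchar w x * mulchar w y.
Proof.
move=> wq; rewrite /mulchar mulf_eq0.
case: eqVneq => x0 /=; first by rewrite mul0r.
case: eqVneq => y0 /=; first by rewrite mulr0.
by rewrite -exprD; apply: expr_eq_mod wq _; apply: indM.
Qed.

Lemma mulchar_mul w1 w2 x : mulchar (w1 * w2) x = mulchar w1 x * mulchar w2 x.
Proof. by rewrite /mulchar; case: eqP; rewrite ?mul0r ?exprMn. Qed.

Lemma ind1 : ind 1 = 0%N %[mod q].
Proof.
have := indM (oner_neq0 'F_p) (oner_neq0 'F_p); rewrite mulr1 => /eqP.
by rewrite -{1}[ind 1]addn0 eqn_modDl eq_sym => /eqP.
Qed.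

Lemma mulchar1 w : w ^+ q = 1 -> mulchar w 1 = 1.
Proof. by move=> wq; rewrite /mulchar oner_eq0 (expr_eq_mod wq ind1). Qed.

(** An odd power of [mulchar w (-1)] and its square are both 1. *)
Lemma mulcharN1 w : w ^+ q = 1 -> mulchar w (-1) = 1.
Proof.
move=> wq; set a := mulchar w (-1).
have a2 : a ^+ 2 = 1 by rewrite expr2 -mulcharM // mulrNN mulr1 mulchar1.
have aq : a ^+ q = 1.
  rewrite /a /mulchar oppr_eq0 oner_eq0 -exprM mulnC exprM wq expr1n //.
by rewrite -[LHS]expr1 -aq; apply: expr_eq_mod a2 _; rewrite !modn2 q_odd.
Qed.

(** A value [w ^+ 1] of the character scales the sum, hence so do all powers of
    [w]; they add up to 0, so [q] times the sum is 0. *)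
Lemma sum_mulchar w : \sum_(i < q) w ^+ i = 0 -> \sum_x mulchar w x = 0.
Proof.
move=> w_sum; have wq := expr_sum0 w_sum; have [v v0 indv] := ind_onto.
set S := \sum_x _.
have wS : w * S = S.
  rewrite {2}/S (reindex_inj (mulfI v0)) /S mulr_sumr; apply: eq_bigr => x _.
  rewrite mulcharM // [mulchar w v]/mulchar (negPf v0).
  by rewrite (expr_eq_mod wq indv) expr1.
have wiS i : w ^+ i * S = S.
  by elim: i => [|i IHi]; rewrite ?mul1r // exprSr -mulrA wS.
apply: (@tfree q.-1); rewrite prednK ?prime_gt0 //.
have : (\sum_(i < q) w ^+ i) * S = 0 by rewrite w_sum mul0r.
rewrite mulr_suml; under eq_bigr => i _ do rewrite wiS.
by rewrite sumr_const card_ord.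
Qed.

(** The sum over the pairs with a given sum [s] is homogeneous in [s]; for
    [s = 0] it vanishes because the product character is nontrivial. *)
Lemma gauss_sumM w1 w2 : w1 ^+ q = 1 -> w2 ^+ q = 1 ->
    \sum_(i < q) (w1 * w2) ^+ i = 0 ->
  gauss_sum w1 * gauss_sum w2 = jacobi_sum w1 w2 * gauss_sum (w1 * w2).
Proof.
move=> w1q w2q w12.
have w12q : (w1 * w2) ^+ q = 1 by rewrite exprMn w1q w2q mulr1.
have conv s : \sum_x mulchar w1 x * mulchar w2 (s - x)
            = mulchar (w1 * w2) s * jacobi_sum w1 w2.
  have [->|s0] := eqVneq s 0.
    rewrite [mulchar _ 0]/mulchar eqxx mul0r.
    transitivity (mulchar w2 (-1) * \sum_x mulchar (w1 * w2) x).
      rewrite mulr_sumr; apply: eq_bigr => x _.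
      by rewrite sub0r -[- x]mulN1r mulcharM // mulchar_mul mulrCA.
    by rewrite sum_mulchar // mulr0.
  rewrite (reindex_inj (mulfI s0)) /jacobi_sum mulr_sumr; apply: eq_bigr => x _.
  rewrite -{2}[s]mulr1 -mulrBr !mulcharM // mulchar_mul; ring.
rewrite /gauss_sum mulr_suml.
transitivity (\sum_x \sum_s mulchar w1 x * mulchar w2 (s - x) * addchar s).
  apply: eq_bigr => x _; rewrite mulr_sumr.
  rewrite [RHS](reindex_inj (addrI x)); apply: eq_bigr => y _.
  by rewrite [x + y]addrC addrK addcharD; ring.
rewrite exchange_big /= mulr_sumr; apply: eq_bigr => s _.
by rewrite -mulr_suml conv; ring.
Qed.

(** Substituting [x * y] for [x] reduces the double sum to sums of the additive
    character along lines, of which only the one with [x = -1] is not -1. *)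
Lemma gauss_sumV w1 w2 : w1 * w2 = 1 -> \sum_(i < q) w1 ^+ i = 0 ->
  gauss_sum w1 * gauss_sum w2 = p%:R.
Proof.
move=> w12 w1_sum; have w1q := expr_sum0 w1_sum.
rewrite /gauss_sum mulrC mulr_suml (bigD1 (0 : 'F_p)) //=.
rewrite {1}/mulchar eqxx !mul0r add0r.
transitivity (\sum_(y | y != 0) \sum_x mulchar w1 x * addchar ((x + 1) * y)).
  apply: eq_bigr => y y0; rewrite mulr_sumr.
  have yI : injective (fun x : 'F_p => x * y) by apply: mulIf.
  rewrite (reindex_inj yI); apply: eq_bigr => x _ /=.
  rewrite mulcharM // mulrDl mul1r addcharD.
  have w12y : mulchar w1 y * mulchar w2 y = 1.
    by rewrite -mulchar_mul w12 /mulchar (negPf y0) expr1n.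
  by rewrite -[X in _ = X]mul1r -w12y; ring.
rewrite exchange_big /=; under eq_bigr => x _ do
  rewrite -mulr_sumr sum_addchar_neq0 mulrBr mulr1.
rewrite sumrB sum_mulchar // subr0 (bigD1 (-1 : 'F_p)) //= addNr eqxx.
rewrite mulcharN1 // mul1r big1 ?addr0 // => x xN1.
by rewrite addr_eq0 (negPf xN1) mulr0.
Qed.

Lemma gauss_sumX w k : \sum_(i < q) w ^+ i = 0 -> (0 < k < q)%N ->
  gauss_sum w ^+ k = gauss_sum (w ^+ k) * \prod_(1 <= j < k) jacobi_sum w (w ^+ j).
Proof.
move=> w_sum; have wq := expr_sum0 w_sum.
case: k => // k /=; elim: k => [|k IHk] kq.
  by rewrite big_geq // mulr1 !expr1.
rewrite exprS IHk 1?ltnW // mulrA gauss_sumM //.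
- by rewrite -exprS [in RHS]big_nat_recr //=; ring.
- by rewrite -exprM mulnC exprM wq expr1n.
by rewrite -exprS; apply: sum_exprX0; rewrite // gtnNdvd.
Qed.

Lemma gauss_sum_expq w : \sum_(i < q) w ^+ i = 0 ->
  gauss_sum w ^+ q = p%:R * \prod_(1 <= j < q.-1) jacobi_sum w (w ^+ j).
Proof.
move=> w_sum; have q_gt2 : (2 < q)%N by rewrite odd_prime_gt2.
have -> : gauss_sum w ^+ q = gauss_sum w * gauss_sum w ^+ q.-1.
  by rewrite -exprS prednK // prime_gt0.
rewrite gauss_sumX //; last by lia.
rewrite mulrA gauss_sumV // -exprS prednK ?prime_gt0 //.
exact: expr_sum0.
Qed.

Section Congruence.

Variable w : R.
Hypothesis w_sum : \sum_(i < q) w ^+ i = 0.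

Let lam := w - 1.

Let w_q : w ^+ q = 1 := expr_sum0 w_sum.

Let wE : w = lam + 1. Proof. by rewrite /lam subrK. Qed.

(** Up to a unit congruent to -1, [q] is [(w - 1) ^+ (q - 1)]: this reads off the
    expansion of [1 + w + ... + w ^+ (q - 1) = 0] in powers of [w - 1], whose
    inner coefficients are binomials divisible by [q]. *)
Lemma natr_lam : exists v, q%:R = - lam ^+ q.-1 + lam ^+ q * v :> R.
Proof.
have q_gt2 : (2 < q)%N by rewrite odd_prime_gt2.
have [u qu] : exists u, q%:R = - lam ^+ q.-1 + lam * q%:R * u :> R.
  have : \sum_(k < q) 'C(q, k.+1)%:R * lam ^+ k = 0.
    by rewrite -sum_expr_bin -wE.
  rewrite -(big_mkord xpredT (fun k => 'C(q, k.+1)%:R * lam ^+ k)).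
  rewrite -{1}(prednK (prime_gt0 q_prime)) big_nat_recr //=.
  rewrite prednK ?prime_gt0 // binn mul1r big_ltn; last by lia.
  rewrite bin1 expr0 mulr1.
  have [u ->] : rdvd (lam * q%:R) (\sum_(1 <= k < q.-1) 'C(q, k.+1)%:R * lam ^+ k).
    rewrite big_nat; apply: rdvd_sum => -[//|k] kq.
    have [|b ->] := @rdvd_bin R _ q_prime k.+2; first by lia.
    by exists (b * lam ^+ k); rewrite exprS; ring.
  by move=> e; exists (- u); rewrite -[LHS]subr0 -e; ring.
have [i iq [y qy]] : exists2 i, i = q.-1 & rdvd (lam ^+ i) q%:R.
  exists q.-1 => //; elim: {-2}q.-1 (leqnn q.-1) => [|i IHi] iq.
    by exists q%:R; rewrite mul1r.
  rewrite qu; apply: rdvdD; first by apply/rdvdN/rdvd_exp.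
  have [y ->] := IHi (ltnW iq).
  by exists (y * u); rewrite exprS; ring.
have lam_q : lam ^+ q = lam * lam ^+ q.-1 by rewrite -exprS prednK // prime_gt0.
by exists (y * u); rewrite {1}qu {1}qy iq lam_q; ring.
Qed.

Lemma rdvd_lam : rdvd lam (q%:R : R).
Proof.
have q_gt2 : (2 < q)%N by rewrite odd_prime_gt2.
have [v ->] := natr_lam; apply: rdvdD; first apply: rdvdN.
  by rewrite -{1}[lam]expr1; apply: rdvd_exp; lia.
by apply: rdvd_mulr; rewrite -{1}[lam]expr1; apply: rdvd_exp; lia.
Qed.

Lemma rcong_lam x y : rcong q%:R x y -> rcong lam x y.
Proof. exact: rdvd_trans rdvd_lam. Qed.

(* [w ^+ k] is [1 + lam * quot k]. *)
Let quot k := \sum_(i < k) w ^+ i.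

Let rcong_quot k : rcong lam (quot k) k%:R.
Proof.
have -> : k%:R = \sum_(i < k) 1 :> R by rewrite sumr_const card_ord.
by apply: rcong_sum => i _; rewrite /rcong subrX1; eexists.
Qed.

Let h := \sum_(x | x != 0) quot (ind x) * addchar x.

Let gauss_sum_h : gauss_sum w = -1 + lam * h.
Proof.
have -> : -1 = \sum_(x : 'F_p | x != 0) addchar x.
  have := sum_addchar_neq0 1; rewrite oner_eq0 sub0r => <-.
  by apply: eq_bigr => x _; rewrite mul1r.
rewrite /gauss_sum (bigD1 (0 : 'F_p)) //= /mulchar eqxx mul0r add0r.
rewrite mulr_sumr -big_split /=; apply: eq_bigr => x x0.
by rewrite (negPf x0) mulrA -subrX1; ring.
Qed.

(** The Frobenius map multiplies the exponent of [z] by [q], so it shifts the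
    indices in [h] by [ind q]. *)
Let rcong_h : p != q -> rcong lam (h - h ^+ q) (- (ind q%:R)%:R).
Proof.
move=> pq; have q0 : q%:R != 0 :> 'F_p.
  by rewrite Fp_natr_eq0 // dvdn_prime2 // (negPf pq).
pose H c := \sum_(x : 'F_p | x != 0) (ind x)%:R * addchar (c * x).
have hH : rcong lam h (\sum_(x : 'F_p | x != 0) (ind x)%:R * addchar x).
  by apply: rcong_sum => x _; apply: rcongM; [apply: rcong_quot|apply: rcong_refl].
have hqH : rcong lam (h ^+ q) (H q%:R).
  apply: rcong_trans (rcong_lam (frobenius_sum _ _ _ _)) _ => //.
  apply: rcong_sum => x _; rewrite exprMn; apply: rcongM.
    apply: rcong_trans (rcongX _ (rcong_quot _)) _.
    by apply: rcong_lam; apply: fermat_rcong.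
  have -> : addchar (q%:R * x) = addchar x ^+ q; last exact: rcong_refl.
  by rewrite /addchar expr_FpM // exprM expr_Fp_nat // -!exprM mulnC.
have HH : rcong lam (\sum_(x : 'F_p | x != 0) (ind x)%:R * addchar x)
                    (H q%:R - (ind q%:R)%:R).
  rewrite (reindex_inj (mulfI q0)) /=.
  under eq_bigl => x do rewrite mulf_eq0 (negPf q0) /=.
  have -> : H q%:R - (ind q%:R)%:R
          = \sum_(x : 'F_p | x != 0) (ind q%:R + ind x)%:R * addchar (q%:R * x).
    under [RHS]eq_bigr => x _ do rewrite natrD mulrDl.
    by rewrite big_split /= -mulr_sumr sum_addchar_neq0 (negPf q0) /H; ring.
  apply: rcong_sum => x x0; apply: rcongM; last exact: rcong_refl.
  by apply/rcong_lam/rcong_nat/indM.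
rewrite /rcong in hH hqH HH *.
have -> : h - h ^+ q - - (ind q%:R)%:R
        = (h - \sum_(x : 'F_p | x != 0) (ind x)%:R * addchar x)
        + (\sum_(x : 'F_p | x != 0) (ind x)%:R * addchar x - (H q%:R - (ind q%:R)%:R))
        - (h ^+ q - H q%:R) by ring.
by apply: rdvdD; [apply: rdvdD|apply: rdvdN].
Qed.

(** In the expansion of [(1 - lam * h) ^+ q] the term of degree 1 is
    [lam ^+ q * h] to this precision, because [q] is [- lam ^+ q.-1]; together
    with the last term it gives [lam ^+ q * (h - h ^+ q)]. *)
Lemma gauss_sum_rcong : p != q ->
  rcong (lam ^+ q.+1) (- gauss_sum w ^+ q) (1 - (ind q%:R)%:R * lam ^+ q).
Proof.
move=> pq; have q_gt2 : (2 < q)%N by rewrite odd_prime_gt2.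
have -> : - gauss_sum w ^+ q = (1 - lam * h) ^+ q.
  have -> : 1 - lam * h = - gauss_sum w by rewrite gauss_sum_h; ring.
  by rewrite [RHS]exprNn -signr_odd q_odd expr1 mulN1r.
have [b ->] : exists b, (1 - lam * h) ^+ q
    = 1 - q%:R * lam * h + q%:R * lam ^+ 2 * b - lam ^+ q * h ^+ q.
  rewrite addrC exprD1n -(big_mkord xpredT (fun i => (- (lam * h)) ^+ i *+ 'C(q, i))).
  rewrite big_nat_recr //= big_ltn 1?big_ltn; try lia.
  rewrite bin0 bin1 binn expr0 expr1 exprNn -signr_odd q_odd exprMn.
  rewrite big_nat.
  have [b ->] : rdvd (q%:R * lam ^+ 2)
      (\sum_(2 <= i < q | (2 <= i < q)%N) (- (lam * h)) ^+ i *+ 'C(q, i)).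
    apply: rdvd_sum => -[|[|i]] // iq.
    have [|y Cy] := @rdvd_bin R _ q_prime i.+2; first by lia.
    exists (y * h ^+ 2 * (- (lam * h)) ^+ i).
    by rewrite -[_ *+ 'C(q, _)]mulr_natr Cy !exprS; ring.
  by exists b; ring.
have [v qv] := natr_lam; have [y hy] := rcong_h pq.
exists (- v * h + b * (-1 + lam * v) + y).
have -> : 1 - q%:R * lam * h + q%:R * lam ^+ 2 * b - lam ^+ q * h ^+ q
    - (1 - (ind q%:R)%:R * lam ^+ q)
  = lam ^+ q * (h - h ^+ q - - (ind q%:R)%:R)
    - (q%:R * lam + lam ^+ q) * h + q%:R * lam * lam * b by ring.
have -> : q%:R * lam = - lam ^+ q + lam ^+ q.+1 * v.
  have lam_q : lam ^+ q = lam * lam ^+ q.-1 by rewrite -exprS prednK // prime_gt0.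
  by rewrite qv exprS lam_q; ring.
by rewrite hy !exprS; ring.
Qed.

End Congruence.

End GaussSums.

(** * A model of the cyclotomic integers *)

Section CyclotomicModel.

Definition evz (R : comNzRingType) (x : R) (P : {poly int}) : R :=
  (map_poly intr P).[x].

HB.instance Definition _ (R : comNzRingType) (x : R) :=
  GRing.RMorphism.copy (evz x) (horner_eval x \o map_poly intr).

Lemma evzX (R : comNzRingType) (x : R) : evz x 'X = x.
Proof. by rewrite /evz map_polyX hornerX. Qed.

Lemma evzC (R : comNzRingType) (x : R) c : evz x c%:P = c%:~R.
Proof. by rewrite /evz map_polyC hornerC. Qed.

Lemma evz_comp (R : comNzRingType) (x : R) P Q : evz x (P \Po Q) = evz (evz x Q) P.
Proof. by rewrite /evz map_comp_poly horner_comp. Qed.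

Lemma rmorph_evz (R S : comNzRingType) (f : {rmorphism R -> S}) x P :
  f (evz x P) = evz (f x) P.
Proof.
rewrite /evz -horner_map -map_poly_comp; congr (_.[_]).
by apply: eq_map_poly => c /=; rewrite rmorph_int.
Qed.

(** For [k] prime this is the [k]-th cyclotomic polynomial. *)
Definition geom (R : nzRingType) k : {poly R} := \sum_(i < k) 'X^i.

Lemma geomE (R : nzRingType) k : geom R k = \poly_(i < k) 1.
Proof. by rewrite /geom poly_def; apply: eq_bigr => i _; rewrite scale1r. Qed.

Lemma size_geom (R : nzRingType) k : size (geom R k) = k.
Proof.
rewrite geomE; case: k => [|k]; last by rewrite size_poly_eq ?oner_eq0.
by rewrite poly_def big_ord0 size_poly0.
Qed.

Lemma geom_monic (R : nzRingType) k : (0 < k)%N -> geom R k \is monic.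
Proof.
case: k => // k _; rewrite monicE lead_coefE size_geom geomE coef_poly /=.
by rewrite ltnSn.
Qed.

Lemma map_geom (R S : nzRingType) (f : {rmorphism R -> S}) k :
  map_poly f (geom R k) = geom S k.
Proof. by rewrite /geom rmorph_sum; apply: eq_bigr => i _ /=; rewrite map_polyXn. Qed.

Lemma evz_geom (R : comNzRingType) (x : R) k : evz x (geom _ k) = \sum_(i < k) x ^+ i.
Proof. by rewrite rmorph_sum; apply: eq_bigr => i _; rewrite rmorphXn /= evzX. Qed.

Lemma mk_monic_geom (R : comNzRingType) k : (1 < k)%N -> mk_monic (geom R k) = geom R k.
Proof. by move=> k1; rewrite /mk_monic size_geom k1 geom_monic // ltnW. Qed.

Lemma evz_qX (h : {poly int}) P : evz (qpolyX h) P = in_qpoly h P.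
Proof.
elim/poly_ind: P => [|P c IH]; first by rewrite !rmorph0.
rewrite !rmorphD !rmorphM /= IH evzX evzC; congr (_ + _).
by rewrite -[c in RHS]intz !rmorph_int.
Qed.

Lemma qpoly_tfree (R : comNzRingType) (h : {poly R}) :
    (forall n (x : R), x *+ n.+1 = 0 -> x = 0) ->
  forall n (x : {poly %/ h}), x *+ n.+1 = 0 -> x = 0.
Proof.
move=> Rtf n x xn0; apply/val_inj/polyP => i /=; rewrite coef0; apply: (Rtf n).
have /(congr1 (fun P : {poly R} => P`_i)) : val (x *+ n.+1) = 0 by rewrite xn0.
by rewrite raddfMn /= coefMn coef0.
Qed.

(** The ring of [q]-th and [p]-th cyclotomic integers as iterated quotients by
    monic polynomials: being free over the inner quotient, the outer one creates
    no new divisibility between elements of the inner one. *)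
Lemma cyclotomic_model p q : (1 < p)%N -> (1 < q)%N ->
  exists (R : comNzRingType) (w z : R),
  [/\ \sum_(i < q) w ^+ i = 0, \sum_(s < p) z ^+ s = 0,
      forall n (x : R), x *+ n.+1 = 0 -> x = 0 &
      forall P Q y, evz w P = evz w Q * y ->
        exists M N, P = Q * M + geom _ q * N].
Proof.
move=> p_gt1 q_gt1.
pose R0 : comNzRingType := {poly %/ geom int q}.
pose R1 : comNzRingType := {poly %/ geom R0 p}.
have kerR0 P : evz (qpolyX (geom int q)) P = 0 -> exists N, P = geom _ q * N.
  rewrite evz_qX => /(congr1 val) /=; rewrite mk_monic_geom // => P0.
  exists (Pdiv.Ring.rdivp P (geom int q)).
  have := Pdiv.RingMonic.rdivp_eq (geom_monic _ (ltnW q_gt1)) P.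
  by rewrite P0 addr0 mulrC.
have sumX (A : comNzRingType) k : (1 < k)%N ->
    \sum_(i < k) (qpolyX (geom A k)) ^+ i = 0.
  move=> k_gt1.
  have -> : \sum_(i < k) (qpolyX (geom A k)) ^+ i = in_qpoly (geom A k) (geom A k).
    by rewrite rmorph_sum; apply: eq_bigr => i _; rewrite rmorphXn.
  by apply/val_inj; rewrite /= mk_monic_geom // Pdiv.RingMonic.rmodpp // geom_monic // ltnW.
exists R1, (qpolyC _ (qpolyX (geom int q))), (qpolyX (geom R0 p)); split.
- under eq_bigr => i _ do rewrite -rmorphXn.
  by rewrite -rmorph_sum /= sumX // rmorph0.
- exact: sumX.
- do 2!apply: qpoly_tfree.
  by move=> n x /eqP; rewrite mulrn_eq0 => /eqP.
move=> P Q y; rewrite -!(rmorph_evz (qpolyC (geom R0 p))) => PQy.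
have {}PQy : evz (qpolyX (geom int q)) P = evz (qpolyX (geom int q)) Q * (val y)`_0.
  have := congr1 (fun u : R1 => (val u)`_0) PQy; rewrite /= coefC /= => ->.
  rewrite mul_polyC Pdiv.Ring.rmodp_small ?coefZ //.
  exact: leq_ltn_trans (size_scale_leq _ _) (size_mk_monic _).
have yE : (val y)`_0 = evz (qpolyX (geom int q)) (val (val y)`_0).
  by rewrite evz_qX; apply/val_inj; rewrite /= Pdiv.Ring.rmodp_small // size_mk_monic.
have [|N PN] := kerR0 (P - Q * val (val y)`_0).
  by rewrite rmorphB rmorphM /= -yE PQy subrr.
by exists (val (val y)`_0), N; rewrite -PN; ring.
Qed.

End CyclotomicModel.

(** * Cyclotomic integers of absolute value 1 *)

Section Pairing.

Variable A : comNzRingType.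

(** Two forms of this kind matter, both given by a [u] of period [q]: the sum of
    the coefficients at the exponents divisible by [q], and, modulo [q ^ 2], the
    value at 1 of the [q]-th Euler derivative. *)
Definition pairing (u : nat -> A) (P : {poly A}) : A := \sum_(i < size P) P`_i * u i.

Lemma pairing_widen u (P : {poly A}) n : (size P <= n)%N -> pairing u P = \sum_(i < n) P`_i * u i.
Proof.
move=> Pn; rewrite /pairing (big_ord_widen _ (fun i => P`_i * u i) Pn).
rewrite [RHS](bigID (fun i : 'I_n => (i < size P)%N)) /= [X in _ + X]big1 ?addr0 //.
by move=> i; rewrite -leqNgt => /(nth_default 0) ->; rewrite mul0r.
Qed.

Fact pairing_is_linear u : linear_for *%R (pairing u).
Proof.
move=> a P Q; pose n := maxn (size P) (size Q).
have sP : (size P <= n)%N by rewrite leq_maxl.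
have sQ : (size Q <= n)%N by rewrite leq_maxr.
rewrite (pairing_widen u sP) (pairing_widen u sQ) (@pairing_widen _ _ n).
  rewrite mulr_sumr -big_split; apply: eq_bigr => i _ /=.
  by rewrite coefD coefZ mulrDl mulrA.
rewrite (leq_trans (size_polyD _ _)) // geq_max sQ andbT.
exact: leq_trans (size_scale_leq _ _) sP.
Qed.

HB.instance Definition _ u :=
  GRing.isLinear.Build A {poly A} A *%R (pairing u) (pairing_is_linear u).

Lemma pairingXn u n : pairing u 'X^n = u n.
Proof.
rewrite /pairing size_polyXn (bigD1 ord_max) //= coefXn eqxx mul1r big1 ?addr0 //.
by move=> i /negPf ni; rewrite coefXn -[_ == n]/(i == ord_max) ni mul0r.
Qed.

Lemma sum_periodic (u : nat -> A) q a : (forall i, u (i + q)%N = u i) ->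
  \sum_(i < q) u (a + i)%N = \sum_(i < q) u i.
Proof.
move=> uq; elim: a => [|a <-]; first by [].
case: q uq => [|q] uq; first by rewrite !big_ord0.
rewrite big_ord_recr big_ord_recl /= addn0 addrC addSnnS uq; congr (_ + _).
by apply: eq_bigr => i _; rewrite addnS.
Qed.

(** Multiplying by [geom A q] sums [u] over [q] consecutive exponents. *)
Lemma pairing_geom (u : nat -> A) q (P : {poly A}) : (forall i, u (i + q)%N = u i) ->
  pairing u (geom A q * P) = (\sum_(i < q) u i) * P.[1].
Proof.
move=> uq; rewrite -{1}[P]coefK poly_def mulr_sumr linear_sum horner_coef mulr_sumr.
apply: eq_bigr => a _; rewrite expr1n mulr1 -scalerAr linearZ /= mulrC; congr (_ * _).
rewrite mulr_suml linear_sum -(sum_periodic a uq); apply: eq_bigr => i _.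
by rewrite -exprD /= pairingXn addnC.
Qed.

End Pairing.

(** Replacing a primitive [q]-th root of unity by a power prime to [q] permutes
    its conjugates. *)
Lemma geom_comp_Xn q a : prime q -> ~~ (q %| a)%N ->
  exists K, geom int q \Po 'X^a = geom _ q * K.
Proof.
move=> q_pr qa.
have [R [w [z [w_sum _ _ model]]]] := @cyclotomic_model 2 q isT (prime_gt1 q_pr).
have [|M [N]] := model (geom int q \Po 'X^a) 0 0; last by rewrite mul0r add0r; exists N.
by rewrite evz_comp evz_geom mulr0 rmorphXn /= evzX sum_exprX0.
Qed.

Lemma sqr_sum1_int q (a : 'I_q -> int) : \sum_i a i ^+ 2 = 1 ->
  exists2 k, a k != 0 & forall i, i != k -> a i = 0.
Proof.
move=> a1; have [k ak] : exists k, a k != 0.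
  apply/existsP; apply: contraTT isT; rewrite negb_exists => /forallP a0.
  move: a1; rewrite big1 // => i _.
  by have := a0 i; rewrite negbK => /eqP ->.
exists k => // i ik; apply/eqP; rewrite -sqrf_eq0 eq_le sqr_ge0 andbT.
move: a1; rewrite (bigD1 k) //= (bigD1 i) //=; set s := \sum_(_ | _) _ => a1.
have ak1 : 1 <= a k ^+ 2 by rewrite -gtz0_ge1 lt_def sqrf_eq0 ak sqr_ge0.
have s0 : 0 <= s by apply: sumr_ge0 => j _; apply: sqr_ge0.
by move: (a k ^+ 2) (a i ^+ 2) s a1 ak1 s0 => x y s; lia.
Qed.

(** The hypothesis says that the conjugates of the cyclotomic integer represented
    by [P] have absolute value 1.  Among its representatives modulo [geom q] choose
    one [S] of size at most [q] and value [+-1] at 1: since [geom q] takes the value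
    [q] at 1 while the coefficients of its multiples at the exponents divisible
    by [q] add up to the value at 1 of the cofactor, the squares of the
    coefficients of [S] add up to 1. *)
Lemma unit_circle_geom q (P M : {poly int}) : prime q ->
    P * (P \Po 'X^(q.-1)) = 1 + geom _ q * M ->
  exists (e : int) k N, e ^+ 2 = 1 /\ P = e%:P * 'X^k + geom _ q * N.
Proof.
move=> q_pr PM; have q_gt1 := prime_gt1 q_pr; have q_gt0 := prime_gt0 q_pr.
have geom1 : (geom int q).[1] = q%:Z.
  by rewrite horner_sum; under eq_bigr => i _ do rewrite hornerXn expr1n;
     rewrite sumr_const card_ord natz.
have comp1 (Q : {poly int}) a : (Q \Po 'X^a).[1] = Q.[1].
  by rewrite horner_comp hornerXn expr1n.
have [e [d [e2 P1]]] : exists e d : int, e ^+ 2 = 1 /\ P.[1] = e + q%:Z * d.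
  have := congr1 (fun Q => Q.[1]) PM; rewrite !hornerE comp1 geom1 => P1.
  have : (q %| (P.[1] - 1) * (P.[1] + 1))%Z.
    apply/dvdzP; exists M.[1].
    have -> : (P.[1] - 1) * (P.[1] + 1) = P.[1] * P.[1] - 1 by ring.
    by rewrite P1; ring.
  rewrite dvdzE abszM Euclid_dvdM // => /orP[] /dvdzP[d Pd].
    by exists 1, d; split; [rewrite expr1n|lia].
  by exists (-1), d; split; [|lia].
have Xq1 : 'X^q - 1 = geom int q * ('X - 1) by rewrite subrX1 mulrC.
have Xq1_monic : 'X^q - 1 \is @monic int by rewrite -[1]/(1%:P) monicXnsubC.
pose T := Pdiv.Ring.rdivp (P - d%:P * geom _ q) ('X^q - 1).
pose S := Pdiv.Ring.rmodp (P - d%:P * geom _ q) ('X^q - 1).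
have TS : P - d%:P * geom _ q = T * ('X^q - 1) + S.
  exact: Pdiv.RingMonic.rdivp_eq.
have sS : (size S <= q)%N.
  have := Pdiv.Ring.ltn_rmodpN0 (P - d%:P * geom _ q) (monic_neq0 Xq1_monic).
  by rewrite -[1]/(1%:P) size_XnsubC // ltnS.
have S1 : S.[1] = e.
  have := congr1 (fun Q => Q.[1]) TS.
  by rewrite !(hornerE, hornerXn) geom1 expr1n P1 subrr mulr0 add0r => <-; ring.
have PS : P = S + geom _ q * (d%:P + T * ('X - 1)).
  have -> : P = P - d%:P * geom _ q + d%:P * geom _ q by ring.
  by rewrite TS Xq1; ring.
have [K gK] : exists K, geom int q \Po 'X^(q.-1) = geom _ q * K.
  by apply: geom_comp_Xn => //; rewrite gtnNdvd //; lia.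
have [M' SM'] : exists M', S * (S \Po 'X^(q.-1)) = 1 + geom _ q * M'.
  move: PM; set N := d%:P + _ in PS *; rewrite {1 2}PS rmorphD rmorphM /= gK => PM.
  exists (M - N * (S \Po 'X^(q.-1)) - S * K * (N \Po 'X^(q.-1))
          - N * geom _ q * K * (N \Po 'X^(q.-1))).
  have -> : 1 + geom _ q * (M - N * (S \Po 'X^(q.-1)) - S * K * (N \Po 'X^(q.-1))
      - N * geom _ q * K * (N \Po 'X^(q.-1))) = (1 + geom _ q * M)
      - geom _ q * (N * (S \Po 'X^(q.-1)) + S * K * (N \Po 'X^(q.-1))
      + N * geom _ q * K * (N \Po 'X^(q.-1))) by ring.
  by rewrite -PM; ring.
have M'1 : M'.[1] = 0.
  have := congr1 (fun Q => Q.[1]) SM'; rewrite !hornerE comp1 geom1 S1 -expr2 e2.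
  move=> e1; have /eqP : q%:Z * M'.[1] = 0 by move: (_ * _) e1; lia.
  by rewrite mulf_eq0 eqz_nat -leqn0 leqNgt q_gt0 => /eqP.
pose u i : int := (q %| i)%N%:R.
have uq i : u (i + q)%N = u i by rewrite /u dvdn_addl.
have sumS : \sum_(i < q) S`_i ^+ 2 = 1.
  have SE : S = \sum_(i < q) S`_i *: 'X^i.
    by rewrite -poly_def; apply/polyP => i; rewrite coef_poly; case: ltnP => // qi;
       rewrite nth_default // (leq_trans sS).
  have : pairing u (S * (S \Po 'X^(q.-1))) = 1.
    rewrite SM' raddfD /= pairing_geom // M'1 mulr0 addr0.
    by rewrite -(expr0 'X) pairingXn /u dvdn0.
  move <-; rewrite {2 3}SE raddf_sum mulr_suml raddf_sum; apply: eq_bigr => i _ /=.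
  rewrite mulr_sumr raddf_sum (bigD1 i) //= big1 ?addr0 => [|j ji].
    rewrite linearZ /= comp_Xn_poly -exprM -scalerAl -scalerAr -exprD.
    rewrite !linearZ /= pairingXn /u.
    have -> : (i + q.-1 * i = q * i)%N by rewrite -mulSn prednK.
    by rewrite dvdn_mulr // mulr1 expr2.
  rewrite linearZ /= comp_Xn_poly -exprM -scalerAl -scalerAr -exprD.
  rewrite !linearZ /= pairingXn /u.
  have -> : (q %| i + q.-1 * j)%N = (i == j).
    rewrite /dvdn -[X in _ == X](mod0n q) -(eqn_modDr j) -addnA -mulSnr prednK // add0n.
    by rewrite addnC mulnC modnMDl !modn_small.
  by rewrite eq_sym (negPf ji) !mulr0.
have [k Sk0 Si0] := sqr_sum1_int sumS.
exists e, (nat_of_ord k), (d%:P + T * ('X - 1)); split=> //.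
rewrite {1}PS; congr (_ + _).
have SE : S = (S`_k)%:P * 'X^k.
  apply/polyP => i; rewrite mul_polyC coefZ coefXn.
  case: (ltnP i q) => [iq|qi]; last first.
    rewrite nth_default ?(leq_trans sS) //.
    by rewrite gtn_eqF ?mulr0 // (leq_trans (ltn_ord k)).
  case: eqVneq => [->|ik]; rewrite ?mulr1 // mulr0.
  by apply: (Si0 (Ordinal iq)).
by rewrite SE; congr (_%:P * _); rewrite -S1 {2}SE hornerM hornerC hornerXn expr1n mulr1.
Qed.

(** * The logarithmic derivative of order q modulo q squared *)

Section LogDerivative.

Variables (A : comNzRingType) (q : nat).
Hypotheses (q_prime : prime q) (q_odd : odd q).
Implicit Types P Q M R : {poly A}.

Definition eulerD P := 'X * P^`().

Definition moment k P : A := pairing (fun j => j%:R ^+ k) P.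

HB.instance Definition _ k :=
  GRing.Linear.copy (moment k) (pairing (fun j => j%:R ^+ k : A)).

Let Y : {poly A} := 'X - 1.

Lemma eulerDM P Q : eulerD (P * Q) = eulerD P * Q + P * eulerD Q.
Proof. by rewrite /eulerD derivM; ring. Qed.

Lemma eulerDD P Q : eulerD (P + Q) = eulerD P + eulerD Q.
Proof. by rewrite /eulerD derivD mulrDr. Qed.

Lemma eulerDC a : eulerD a%:P = 0.
Proof. by rewrite /eulerD derivC mulr0. Qed.

Lemma eulerDX P k : eulerD (P ^+ k.+1) = k.+1%:R * P ^+ k * eulerD P.
Proof. by rewrite /eulerD deriv_exp -mulr_natl /=; ring. Qed.

Lemma coef_eulerD P i : (eulerD P)`_i = P`_i * i%:R.
Proof.
rewrite /eulerD coefXM; case: i => [|i]; first by rewrite mulr0.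
by rewrite coef_deriv mulr_natr.
Qed.

Lemma moment_eulerD k P : moment k (eulerD P) = moment k.+1 P.
Proof.
rewrite /moment (@pairing_widen _ _ (eulerD P) (size P)).
  by apply: eq_bigr => i _; rewrite coef_eulerD exprS mulrA.
by apply/leq_sizeP => i Pi; rewrite coef_eulerD nth_default ?mul0r.
Qed.

Lemma moment0 P : moment 0 P = P.[1].
Proof.
by rewrite horner_coef; apply: eq_bigr => i _; rewrite expr0 expr1n.
Qed.

Lemma eulerD_rdvd n P : rdvd (Y ^+ n.+1) P -> rdvd (Y ^+ n) (eulerD P).
Proof.
move=> [M ->]; rewrite eulerDM eulerDX.
exists (n.+1%:R * eulerD Y * M + Y * eulerD M); rewrite exprS; ring.
Qed.

Lemma moment_rdvd k P : rdvd (Y ^+ k.+1) P -> moment k P = 0.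
Proof.
elim: k P => [|k IHk] P.
  move=> [M ->]; rewrite moment0 expr1 hornerM.
  by rewrite !hornerE subrr mul0r.
by move/eulerD_rdvd/IHk; rewrite moment_eulerD.
Qed.

Lemma moment_rcong k P Q : rcong (Y ^+ k.+1) P Q -> moment k P = moment k Q.
Proof. by move=> /moment_rdvd /eqP; rewrite raddfB subr_eq0 => /eqP. Qed.

(** [c] is the value at 1 of the [q]-th derivative of [log P] along ['X * d/dX],
    that is, the coefficient of [v ^ q / q!] in [log (P (exp v))]; the inverse of
    [P] matters only modulo [('X - 1) ^+ q]. *)
Definition logder P c :=
  exists2 Q, rcong (Y ^+ q.+1) (P * Q) 1 & c = moment q.-1 (Q * eulerD P).

Let q_gt2 : (2 < q)%N. Proof. by rewrite odd_prime_gt2. Qed.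

Let moment_pred P : rdvd (Y ^+ q) P -> moment q.-1 P = 0.
Proof. by move=> qP; apply: moment_rdvd; rewrite prednK // prime_gt0. Qed.

Lemma logder_rcong P P' c : rcong (Y ^+ q.+1) P P' -> logder P c -> logder P' c.
Proof.
move=> PP' [Q PQ ->]; exists Q.
  by apply: rcong_trans PQ; apply: rcongM; [apply: rcong_sym|apply: rcong_refl].
apply/eqP; rewrite -subr_eq0 -raddfB -mulrBr; apply/eqP/moment_pred/rdvd_mull.
have -> : eulerD P - eulerD P' = eulerD (P - P').
  by rewrite /eulerD derivB mulrBr.
exact: eulerD_rdvd.
Qed.

Lemma logder_uniq P c c' : logder P c -> logder P c' -> c = c'.
Proof.
move=> [Q PQ ->] [Q' PQ' ->]; apply/eqP; rewrite -subr_eq0 -raddfB -mulrBl.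
apply/eqP/moment_pred/rdvd_mulr.
have -> : Q - Q' = Q' * (P * Q - 1) - Q * (P * Q' - 1) by ring.
have Yq : rdvd (Y ^+ q) (Y ^+ q.+1) by apply: rdvd_exp.
apply: rdvdD; first by apply/rdvd_mull/(rdvd_trans Yq).
by apply/rdvdN/rdvd_mull/(rdvd_trans Yq).
Qed.

Lemma logder_exists P b : P.[1] * b = 1 -> exists c, logder P c.
Proof.
move=> Pb; suff [Q PQ] : exists Q, rcong (Y ^+ q.+1) (P * Q) 1.
  by eexists; exists Q.
have [M PM] : rdvd Y (1 - P * b%:P).
  have /factor_theorem[M PM] : root (1 - P * b%:P) 1.
    by rewrite /root !hornerE Pb subrr.
  by exists M; rewrite PM mulrC.
exists (b%:P * \sum_(i < q.+1) (1 - P * b%:P) ^+ i).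
rewrite mulrA; set T := \sum_(i < _) _.
have := subrX1 (1 - P * b%:P) q.+1; rewrite -/T => e.
exists (- M ^+ q.+1).
have -> : P * b%:P * T - 1 = - (1 - P * b%:P) ^+ q.+1.
  have -> : P * b%:P * T = - ((1 - P * b%:P - 1) * T) by ring.
  by rewrite -e; ring.
by rewrite PM exprMn mulrN.
Qed.

(** The inverses of the two factors multiply, and the logarithmic derivative of a
    product is a sum. *)
Lemma logderM P1 P2 c1 c2 :
  logder P1 c1 -> logder P2 c2 -> logder (P1 * P2) (c1 + c2).
Proof.
move=> [Q1 PQ1 ->] [Q2 PQ2 ->]; exists (Q1 * Q2).
  have -> : P1 * P2 * (Q1 * Q2) = P1 * Q1 * (P2 * Q2) by ring.
  by rewrite -[1](mulr1 1); apply: rcongM.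
rewrite -raddfD eulerDM; apply: esym; apply/eqP; rewrite -subr_eq0 -raddfB.
apply/eqP/moment_pred.
have -> : Q1 * Q2 * (eulerD P1 * P2 + P1 * eulerD P2)
          - (Q1 * eulerD P1 + Q2 * eulerD P2)
        = Q1 * eulerD P1 * (P2 * Q2 - 1) + Q2 * eulerD P2 * (P1 * Q1 - 1) by ring.
have Yq : rdvd (Y ^+ q) (Y ^+ q.+1) by apply: rdvd_exp.
by apply: rdvdD; apply/rdvd_mull/(rdvd_trans Yq).
Qed.

Lemma logderC a b : a * b = 1 -> logder a%:P 0.
Proof.
move=> ab; exists b%:P; first by rewrite -polyCM ab; apply: rcong_refl.
by rewrite eulerDC mulr0 raddf0.
Qed.

Lemma logder_prod I (r : seq I) (pr : pred I) (F : I -> {poly A}) (c : I -> A) :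
    (forall i, pr i -> logder (F i) (c i)) ->
  logder (\prod_(i <- r | pr i) F i) (\sum_(i <- r | pr i) c i).
Proof.
move=> Fc; elim/big_rec2: _ => [|i x y /Fc]; last exact: logderM.
by apply: (@logderC 1 1); rewrite mulr1.
Qed.

Lemma logderX P c k : logder P c -> logder (P ^+ k) (k%:R * c).
Proof.
move=> Pc; elim: k => [|k IHk].
  by rewrite mul0r; apply: (@logderC 1 1); rewrite mulr1.
by rewrite exprS -addn1 natrD mulrDl mul1r addrC; apply: logderM.
Qed.

Lemma logder_X : logder 'X 0.
Proof.
have [|c Xc] := @logder_exists 'X 1; first by rewrite hornerX mulr1.
case: (Xc) => Q XQ cE; suff <- : c = 0 by [].
rewrite cE /eulerD derivX mulr1 mulrC.
rewrite (@moment_rcong _ _ 1); last first.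
  by apply: rdvd_trans XQ; apply: rdvd_exp; lia.
have -> : q.-1 = q.-2.+1 by lia.
by rewrite -moment_eulerD -polyC1 eulerDC raddf0.
Qed.

Lemma eulerD_comp_Xn P s : eulerD (P \Po 'X^s) = s%:R * (eulerD P \Po 'X^s).
Proof.
rewrite /eulerD deriv_comp derivXn comp_polyM comp_polyX.
case: s => [|s]; first by rewrite mulr0n !mulr0 mul0r.
by rewrite -mulr_natl exprS; ring.
Qed.

Lemma horner_comp_Xn1 P s : (P \Po 'X^s).[1] = P.[1].
Proof. by rewrite horner_comp hornerXn expr1n. Qed.

Lemma moment_comp_Xn k P s : moment k (P \Po 'X^s) = s%:R ^+ k * moment k P.
Proof.
elim: k P => [|k IHk] P; first by rewrite !moment0 horner_comp_Xn1 mul1r.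
rewrite -!moment_eulerD eulerD_comp_Xn -polyC_natr mul_polyC linearZ /=.
by rewrite IHk exprS mulrA.
Qed.

(** In terms of [v], substituting ['X^s] for ['X] replaces [v] by [s * v]. *)
Lemma logder_comp_Xn P c s : logder P c -> logder (P \Po 'X^s) (s%:R ^+ q * c).
Proof.
move=> [Q [M PQ] ->]; exists (Q \Po 'X^s).
  rewrite /rcong -comp_polyM -[X in _ - X](comp_polyC 1 'X^s) -rmorphB /= PQ.
  rewrite rmorphM /= rmorphXn /= rmorphB /= comp_polyX rmorph1.
  apply: rdvd_mulr; rewrite subrX1 exprMn; apply: rdvd_mulr.
  by exists 1; rewrite mulr1.
rewrite eulerD_comp_Xn [(Q \Po _) * _]mulrCA -comp_polyM -polyC_natr mul_polyC linearZ /=.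
by rewrite moment_comp_Xn [in RHS]mulrA -exprS prednK // prime_gt0.
Qed.

(** Clearing denominators in the iterated Euler derivatives of [eulerD P / P]. *)
Fixpoint logder_num P k : {poly A} :=
  if k is k'.+1 then
    P * eulerD (logder_num P k') - k'.+1%:R * eulerD P * logder_num P k'
  else eulerD P.

Lemma logder_numE P c : logder P c -> c * P.[1] ^+ q = (logder_num P q.-1).[1].
Proof.
move=> [Q PQ ->].
have Yq : rdvd (Y ^+ q) (Y ^+ q.+1) by apply: rdvd_exp.
have DPQ : rdvd (Y ^+ q) (P * eulerD Q + Q * eulerD P).
  have -> : P * eulerD Q + Q * eulerD P = eulerD (P * Q - 1).
    by rewrite -polyC1 -polyCN eulerDD eulerDC eulerDM; ring.
  exact: eulerD_rdvd.
have step k : (k <= q.-1)%N ->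
    moment q.-1 (Q * eulerD P) = moment (q.-1 - k) (Q ^+ k.+1 * logder_num P k).
  elim: k => [|k IHk] kq; first by rewrite subn0 expr1.
  rewrite IHk ?(ltnW kq) // -[(q.-1 - k)%N]prednK ?subn_gt0 // -subnS -moment_eulerD.
  apply: moment_rcong; apply: (@rdvd_trans _ _ (Y ^+ q)).
    by apply: rdvd_exp; lia.
  rewrite eulerDM eulerDX /=.
  have -> : k.+1%:R * Q ^+ k * eulerD Q * logder_num P k
      + Q ^+ k.+1 * eulerD (logder_num P k)
      - Q ^+ k.+2 * (P * eulerD (logder_num P k)
                     - k.+1%:R * eulerD P * logder_num P k)
    = Q ^+ k * (- Q * eulerD (logder_num P k)
                - k.+1%:R * logder_num P k * eulerD Q) * (P * Q - 1)
      + k.+1%:R * Q ^+ k.+1 * logder_num P k * (P * eulerD Q + Q * eulerD P).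
    by rewrite !exprS; ring.
  by apply: rdvdD; apply: rdvd_mull => //; apply: rdvd_trans Yq _.
rewrite (step q.-1) // subnn moment0 prednK ?prime_gt0 // hornerM horner_exp.
have PQ1 : P.[1] * Q.[1] = 1.
  have /moment_rcong : rcong (Y ^+ 1) (P * Q) 1.
    by apply: rdvd_trans PQ; apply: rdvd_exp.
  by rewrite !moment0 hornerM -polyC1 hornerC.
by rewrite mulrAC -exprMn [Q.[1] * _]mulrC PQ1 expr1n mul1r.
Qed.

Lemma moment_expY (k : nat) : moment k (Y ^+ k) = k`!%:R.
Proof.
elim: k => [|k IHk]; first by rewrite moment0 expr0 -polyC1 hornerC.
rewrite -moment_eulerD eulerDX.
have -> : eulerD Y = Y + 1.
  by rewrite /eulerD derivB derivX -polyC1 derivC subr0 mulr1 subrK.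
rewrite (@moment_rcong _ _ (k.+1%:R * Y ^+ k)).
  by rewrite -polyC_natr mul_polyC linearZ /= IHk factS natrM.
by exists (k.+1%:R); rewrite exprS; ring.
Qed.

Lemma logder_1subYq a : logder (1 - a%:P * Y ^+ q) (- a * q`!%:R).
Proof.
exists (1 + a%:P * Y ^+ q).
  exists (- (a%:P ^+ 2 * Y ^+ q.-1)).
  have Yq : Y ^+ q = Y * Y ^+ q.-1 by rewrite -exprS prednK // prime_gt0.
  by rewrite exprS Yq; ring.
rewrite -moment_expY -(prednK (prime_gt0 q_prime)) -moment_eulerD /=.
rewrite prednK ?prime_gt0 //.
have -> : eulerD (1 - a%:P * Y ^+ q) = - a%:P * eulerD (Y ^+ q).
  rewrite -polyC1 -mulNr -polyCN eulerDD eulerDM !eulerDC; ring.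
transitivity (moment q.-1 (- a *: eulerD (Y ^+ q))); first by rewrite linearZ.
rewrite -mul_polyC polyCN; apply/esym/moment_rcong.
rewrite prednK ?prime_gt0 //; exists (- a%:P ^+ 2 * eulerD (Y ^+ q)); ring.
Qed.

Hypothesis q2_eq0 : q%:R * q%:R = 0 :> A.

(** The binomial expansion stops at the linear term, which has a factor
    [q * q]: modulo [q ^ 2], a [q]-th power depends only on the residue modulo [q]. *)
Lemma expr_addq (x : A) : (x + q%:R) ^+ q = x ^+ q.
Proof.
have e k : (x + q%:R) ^+ k.+1 = x ^+ k.+1 + q%:R * (k.+1%:R * x ^+ k).
  elim: k => [|k IHk]; first by rewrite !expr1 expr0 !mulr1.
  rewrite exprS IHk [k.+2%:R]mulrS; rewrite !exprS; set y := x ^+ k.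
  have -> : (x + q%:R) * (x * y + q%:R * (k.+1%:R * y))
    = x * (x * y) + q%:R * ((1 + k.+1%:R) * (x * y)) + q%:R * q%:R * (k.+1%:R * y).
    by ring.
  by rewrite q2_eq0 mul0r addr0.
by have := e q.-1; rewrite prednK ?prime_gt0 // mulrA q2_eq0 mul0r addr0.
Qed.

(** The [q]-th powers of [i] and [q - i] are opposite modulo [q ^ 2]. *)
Lemma sum_exprq : \sum_(i < q) (i%:R : A) ^+ q = 0.
Proof.
set T := \sum_(i < q) _.
have qper i : ((i + q)%:R : A) ^+ q = i%:R ^+ q by rewrite natrD expr_addq.
have TN : T = - T.
  rewrite {2}/T -(sum_periodic 1 qper) -sumrN /T (reindex_inj rev_ord_inj) /=.
  apply: eq_bigr => i _; rewrite natrB // -addn1 addnC -[q%:R + _]addrC expr_addq.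
  by rewrite exprNn -signr_odd q_odd mulN1r.
have T2 : T *+ 2 = 0 by rewrite mulr2n {1}TN addNr.
rewrite -[T]mulr1n; have -> : (1 = q * q - (q * q)./2.*2)%N.
  by have := odd_double_half (q * q); rewrite oddM q_odd; lia.
rewrite mulrnBr; last by have := odd_double_half (q * q); lia.
by rewrite -mulr_natr natrM q2_eq0 mulr0 -muln2 mulnC mulrnA T2 mul0rn subrr.
Qed.

(* Fermat's little theorem, multiplied by [q]. *)
Let qmoment (P : {poly A}) : q%:R * moment q P = q%:R * moment 1 P.
Proof.
rewrite !mulr_sumr; apply: eq_bigr => i _; rewrite expr1 !mulrA ![q%:R * _]mulrC.
rewrite -!mulrA; congr (_ * _); have [y iq] := fermat_rcong A q_prime i.
by apply/eqP; rewrite -subr_eq0 -mulrBr iq mulrA q2_eq0 mul0r.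
Qed.

Let geomY : exists B, geom A q = Y ^+ q.-1 + q%:R * B.
Proof.
have -> : geom A q = \sum_(i < q) (Y + 1) ^+ i.
  by apply: eq_bigr => i _; rewrite subrK.
rewrite sum_expr_bin -(big_mkord xpredT (fun k => 'C(q, k.+1)%:R * Y ^+ k)).
rewrite -{1}(prednK (prime_gt0 q_prime)) big_nat_recr //=.
rewrite prednK ?prime_gt0 // binn mul1r addrC.
suff [B ->] : rdvd q%:R (\sum_(0 <= k < q.-1) 'C(q, k.+1)%:R * Y ^+ k) by exists B.
rewrite big_nat; apply: rdvd_sum => k kq.
by apply: rdvd_mulr; apply: rdvd_bin => //; lia.
Qed.

(** [geom A q] represents 0 in the cyclotomic integers.  Writing
    [geom A q * R = V + q * B] with [V] divisible by [('X - 1) ^+ (q - 1)], all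
    terms of [log (1 + geom A q * R)] beyond the linear one vanish modulo [q ^ 2]
    by Fermat, and the linear one is a combination of sums of [q]-th powers of
    [q] consecutive integers. *)
Lemma logder_1geom R : logder (1 + geom A q * R) 0.
Proof.
have [B gE] := geomY; set W := geom A q * R.
pose V := Y ^+ q.-1 * R; pose C := B * R.
have WE : W = V + q%:R * C by rewrite /W gE /V /C; ring.
have q2 : q%:R * q%:R = 0 :> {poly A} by rewrite -!polyC_natr -polyCM q2_eq0.
have VV : exists y, V * V = Y ^+ q.+1 * y.
  have [y Yy] : rdvd (Y ^+ q.+1) (Y ^+ q.-1 * Y ^+ q.-1).
    by rewrite -exprD; apply: rdvd_exp; lia.
  by exists (y * R * R); rewrite /V mulrACA Yy; ring.
have [y VVy] := VV.
have DV : exists v, eulerD V = Y ^+ q.-2 * v.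
  apply: eulerD_rdvd; have -> : q.-2.+1 = q.-1 by lia.
  by exists R.
have [v DVv] := DV.
have [t VDVt] : rdvd (Y ^+ q) (V * eulerD V).
  rewrite DVv /V; have [t Yt] : rdvd (Y ^+ q) (Y ^+ q.-1 * Y ^+ q.-2).
    by rewrite -exprD; apply: rdvd_exp; lia.
  by exists (t * R * v); rewrite mulrACA Yt; ring.
have DW : eulerD W = eulerD V + q%:R * eulerD C.
  by rewrite WE eulerDD eulerDM -polyC_natr eulerDC mul0r add0r.
exists (1 - W + W ^+ 2).
  exists (y * (V + 3 * q%:R * C)).
  have -> : (1 + W) * (1 - W + W ^+ 2) - 1 = W * W * W by ring.
  have -> : W * W * W = V * V * (V + 3 * q%:R * C)
      + q%:R * q%:R * (3 * V * C * C + q%:R * C * C * C) by rewrite WE; ring.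
  by rewrite q2 mul0r addr0 VVy; ring.
have -> : eulerD (1 + W) = eulerD W by rewrite eulerDD -polyC1 eulerDC add0r.
have -> : (1 - W + W ^+ 2) * eulerD W = eulerD W - q%:R * eulerD (V * C)
    + Y ^+ q * (- t + Y * y * eulerD W + 2 * q%:R * C * t).
  transitivity (eulerD W - V * eulerD V - q%:R * eulerD (V * C)
     + V * V * eulerD W + 2 * q%:R * C * (V * eulerD V)
     + q%:R * q%:R * (- C * eulerD C + 2 * V * C * eulerD C + C * C * eulerD W)).
    by rewrite eulerDM DW WE; ring.
  by rewrite q2 mul0r addr0 VVy VDVt exprS; ring.
rewrite raddfD raddfB /= [X in _ + X]moment_pred ?addr0; last by eexists.
rewrite moment_eulerD prednK ?prime_gt0 //.
have -> : moment q W = 0.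
  by rewrite /moment /W pairing_geom ?sum_exprq ?mul0r // => i; rewrite natrD expr_addq.
rewrite -polyC_natr mul_polyC linearZ /= moment_eulerD prednK ?prime_gt0 //.
rewrite qmoment moment_rdvd ?mulr0 ?subr0 //.
apply: rdvd_mulr; apply: rdvd_mulr; apply: rdvd_exp; lia.
Qed.

(** Since [P] is invertible, adding a multiple of [geom A q] amounts to
    multiplying by a polynomial of the form [1 + geom A q * R]. *)
Lemma logder_geom P R b c : P.[1] * b = 1 -> logder P c -> logder (P + geom A q * R) c.
Proof.
move=> Pb Pc; case: (Pc) => Q [M PQ] _; rewrite -[c]addr0.
apply: logder_rcong (logderM Pc (logder_1geom (R * Q))).
exists (geom A q * R * M).
have -> : Y ^+ q.+1 * (geom A q * R * M) = geom A q * R * (Y ^+ q.+1 * M) by ring.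
by rewrite -PQ; ring.
Qed.

End LogDerivative.

(** * Divisibility of Jacobi sums *)

Section Stickelberger.

Variables (p q f : nat).
Hypotheses (p_prime : prime p) (q_prime : prime q) (p_qf : (p.-1 = q * f)%N).

(** Some nonzero [v] has [v ^+ k != 1], as ['X^k - 1] has fewer than [p - 1]
    roots; scaling by [v] multiplies the sum by [v ^+ k]. *)
Lemma sum_Fp_exp k : (k < p.-1)%N -> \sum_(x : 'F_p) x ^+ k = 0.
Proof.
move=> kp; case: (posnP k) => [->|k0].
  under eq_bigr => x _ do rewrite expr0.
  by rewrite sumr_const card_Fp // pchar_Fp_0.
have [v v0 vk] : exists2 v : 'F_p, v != 0 & v ^+ k != 1.
  apply/exists_inP; apply: contraTT isT; rewrite negb_exists_in => /forall_inP vk.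
  have : (size (enum (predC1 (0 : 'F_p)%R)) < size ('X^k - 1%:P : {poly 'F_p})%R)%N.
    apply: max_poly_roots; rewrite ?enum_uniq //.
      by rewrite -size_poly_gt0 size_XnsubC.
    apply/allP => v; rewrite mem_enum => v0.
    by rewrite /root !hornerE; have := vk v v0; rewrite negbK => /eqP ->; rewrite subrr.
  rewrite size_XnsubC // -cardE; have := cardC1 (0 : 'F_p); rewrite card_Fp // => ->.
  by rewrite ltnS leqNgt kp.
set S := \sum_x _; have vS : v ^+ k * S = S.
  rewrite {2}/S (reindex_inj (mulfI v0)) /S mulr_sumr.
  by apply: eq_bigr => x _; rewrite exprMn.
apply/eqP; have /eqP : (v ^+ k - 1) * S = 0 by rewrite mulrBl vS mul1r subrr.
by rewrite mulf_eq0 subr_eq0 (negPf vk).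
Qed.

Lemma sum_Fp_horner (P : {poly 'F_p}) : (size P < p)%N -> \sum_x P.[x] = 0.
Proof.
move=> sP; under eq_bigr => x _ do rewrite horner_coef.
rewrite exchange_big big1 //= => i _; rewrite -mulr_sumr sum_Fp_exp ?mulr0 //.
by rewrite -ltnS prednK ?prime_gt0 //; apply: leq_ltn_trans (ltn_ord i) sP.
Qed.

Variable r : 'F_p.
Hypothesis r_prim : q.-primitive_root r.

Let r_q : r ^+ q = 1 := prim_expr_order r_prim.

(** Every nonzero residue class modulo [q] gives a root of [geom 'F_p q], and
    these [q - 1] roots are distinct. *)
Lemma evz_roots_dvd P : (forall t, (0 < t < q)%N -> evz (r ^+ t) P = 0) ->
  exists R M, P = p%:R * R + geom _ q * M.
Proof.
move=> P0; have q_gt0 := prime_gt0 q_prime.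
pose S := Pdiv.Ring.rmodp P (geom int q).
have PS : P = Pdiv.Ring.rdivp P (geom int q) * geom _ q + S.
  exact/Pdiv.RingMonic.rdivp_eq/geom_monic.
have sS : (size S < q)%N.
  by have := Pdiv.Ring.ltn_rmodpN0 P (monic_neq0 (geom_monic int q_gt0)); rewrite size_geom.
have rt_inj t s : (t < q)%N -> (s < q)%N -> r ^+ t = r ^+ s -> t = s.
  by move=> tq sq /eqP; rewrite (eq_prim_root_expr r_prim) !modn_small // => /eqP.
have Sp0 : map_poly intr S = 0 :> {poly 'F_p}.
  apply: (@roots_geq_poly_eq0 _ _ [seq r ^+ t | t <- iota 1 q.-1]).
  - apply/allP => x /mapP[t]; rewrite mem_iota add1n prednK // => tq ->.
    have geom0 : evz (r ^+ t) (geom int q) = 0.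
      rewrite evz_geom; have rt1 : r ^+ t - 1 != 0.
        rewrite subr_eq0 -(expr0 r) (eq_prim_root_expr r_prim) mod0n modn_small; lia.
      by apply: (mulfI rt1); rewrite -subrX1 exprAC r_q expr1n subrr mulr0.
    apply/rootP; rewrite -[LHS]/(evz _ S) -(P0 t) //.
    by rewrite PS rmorphD rmorphM /= geom0 mulr0 add0r.
  - rewrite map_inj_in_uniq ?iota_uniq // => t s; rewrite !mem_iota => tq sq.
    by apply: rt_inj; lia.
  rewrite size_map size_iota; apply: leq_trans (size_poly _ _) _.
  by rewrite -ltnS prednK.
exists (\poly_(i < size S) (S`_i %/ p)%Z), (Pdiv.Ring.rdivp P (geom int q)).
rewrite {1}PS addrC mulrC; congr (_ + _).
apply/polyP => i; rewrite -polyC_natr coefCM coef_poly.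
case: ltnP => iS; last by rewrite mulr0 nth_default.
rewrite mulrC natz divzK //.
have := congr1 (fun Q : {poly 'F_p} => Q`_i) Sp0; rewrite coef_map coef0 /=.
by move/eqP; rewrite -(dvdz_pcharf (pchar_Fp p_prime)).
Qed.

Variable ind : 'F_p -> nat.
Hypothesis r_ind : forall x, x != 0 -> r ^+ ind x = x ^+ f.

(** The Jacobi sum of the characters sending [x] to [w ^+ ind x] and to
    [w ^+ (j * ind x)], lifted to a polynomial in [w]. *)
Definition jacobi_poly j : {poly int} :=
  \sum_(x : 'F_p | (x != 0) && (x != 1)) 'X^(ind x + j * ind (1 - x)).

Lemma evz_jacobi_poly (R : comNzRingType) (w : R) j :
  evz w (jacobi_poly j) = jacobi_sum ind w (w ^+ j).
Proof.
rewrite rmorph_sum /jacobi_sum [RHS](bigID (fun x : 'F_p => (x != 0) && (x != 1))) /=.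
rewrite [X in _ = _ + X]big1 ?addr0 => [|x]; last first.
  rewrite negb_and !negbK /mulchar => /orP[] /eqP->; rewrite ?eqxx ?mul0r //.
  by rewrite subrr eqxx mulr0.
apply: eq_bigr => x /andP[x0 x1].
rewrite rmorphXn /= evzX exprD exprM /mulchar (negPf x0) subr_eq0 eq_sym.
by rewrite (negPf x1).
Qed.

(** Modulo the prime above [p] on which [w] is [r ^+ t], a Jacobi sum is the sum
    over ['F_p] of the polynomial ['X^a * (1 - 'X)^b]; such a sum vanishes unless
    the degree reaches [p - 1]. *)
Lemma evz_jacobi_poly_eq0 t j : (0 < t < q)%N -> (0 < j < q)%N ->
  (t + (t * j) %% q < q)%N -> evz (r ^+ t) (jacobi_poly j) = 0.
Proof.
move=> tq jq tjq; have p_gt1 := prime_gt1 p_prime.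
have f_gt0 : (0 < f)%N by case: (posnP f) p_qf => // ->; lia.
pose a := (f * t)%N; pose b := (f * ((t * j) %% q))%N.
have a_gt0 : (0 < a)%N by rewrite muln_gt0 f_gt0; case/andP: tq.
have b_gt0 : (0 < b)%N.
  rewrite muln_gt0 f_gt0 lt0n -/(dvdn q (t * j)) Euclid_dvdM // negb_or.
  by rewrite !gtnNdvd //; lia.
pose P : {poly 'F_p} := 'X^a * (1 - 'X) ^+ b.
rewrite -[RHS](@sum_Fp_horner P); last first.
  have sb : (size ((1 - 'X : {poly 'F_p}) ^+ b)%R <= b.+1)%N.
    rewrite (leq_trans (size_poly_exp_leq _ _)) //.
    have -> : size (1 - 'X : {poly 'F_p}) = 2%N.
      by rewrite -opprB size_polyN -polyC1 size_XsubC.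
    by rewrite mul1n.
  have ab : (a + b < q * f)%N.
    by rewrite /a /b -mulnDr mulnC ltn_mul2r f_gt0.
  apply: leq_ltn_trans (size_polyMleq _ _) _; rewrite size_polyXn addSn /=.
  apply: (@leq_ltn_trans (a + b.+1)); first by rewrite leq_add2l.
  by rewrite addnS -[X in (_ < X)%N]prednK ?prime_gt0 // p_qf.
rewrite rmorph_sum [RHS](bigID (fun x : 'F_p => (x != 0) && (x != 1))) /=.
rewrite [X in _ = _ + X]big1 ?addr0 => [|x]; last first.
  rewrite negb_and !negbK /P !hornerE => /orP[] /eqP->.
    by rewrite expr0n [a == 0%N]eqn0Ngt a_gt0 mul0r.
  by rewrite subrr expr0n [b == 0%N]eqn0Ngt b_gt0 mulr0.
apply: eq_bigr => x /andP[x0 x1].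
rewrite rmorphXn /= evzX /P hornerM hornerXn horner_exp !hornerE exprD.
congr (_ * _); first by rewrite exprAC r_ind // -exprM.
have x10 : 1 - x != 0 by rewrite subr_eq0 eq_sym.
have -> : r ^+ t ^+ (j * ind (1 - x)) = (r ^+ ind (1 - x)) ^+ (t * j).
  by rewrite -!exprM; congr (_ ^+ _); ring.
rewrite r_ind // -exprM /b -(expr_mod (f * (t * j)) (Fp_expf_pred p_prime x10)).
by rewrite p_qf [(q * f)%N]mulnC -muln_modr.
Qed.

Variables (m n : int) (inv : nat -> nat).
Hypotheses (m_nr : m%:~R = n%:~R * r :> 'F_p)
  (invE : forall t, (0 < t < q)%N -> (t * inv t)%N = 1%N %[mod q]).

(** For [0 < t < q] this is 1 or 0 according to whether [t] and the residue of
    [t * j] add up to at least [q]; in this form the carries telescope over [j]. *)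
Definition carry t j : nat := (t * j.+1 %/ q - t * j %/ q)%N.

Definition linear_poly (a b : int) : {poly int} := a%:P - b%:P * 'X.

Lemma evz_linear_poly (R : comNzRingType) (w : R) a b :
  evz w (linear_poly a b) = a%:~R - b%:~R * w.
Proof. by rewrite rmorphB rmorphM /= !evzC evzX. Qed.

Lemma evz_comp_Xn (R : comNzRingType) (w : R) k P :
  evz w (P \Po 'X^k) = evz (w ^+ k) P.
Proof. by rewrite evz_comp rmorphXn /= evzX. Qed.

(** Each prime above [p] divides the Jacobi sum or one of the linear factors. *)
Lemma jacobi_poly_dvd j : (0 < j < q)%N -> exists R M,
  jacobi_poly j * \prod_(1 <= t < q) (linear_poly m n \Po 'X^(inv t)) ^+ carry t j
  = p%:R * R + geom _ q * M.
Proof.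
move=> jq; apply: evz_roots_dvd => t tq; rewrite rmorphM /=.
have [small|large] := ltnP (t + (t * j) %% q) q.
  by rewrite evz_jacobi_poly_eq0 // mul0r.
rewrite rmorph_prod /= (bigD1_seq t) ?iota_uniq //=; last first.
  by rewrite mem_index_iota.
have carry_gt0 : (0 < carry t j)%N.
  rewrite subn_gt0 mulnS {2}(divn_eq (t * j) q) addnCA divnMDl ?prime_gt0 //.
  by rewrite -[X in (X < _)%N]addn0 ltn_add2l divn_gt0 ?prime_gt0.
rewrite rmorphXn /= evz_comp_Xn evz_linear_poly -exprM.
rewrite (expr_eq_mod r_q (invE tq)) m_nr expr1 subrr expr0n.
by rewrite eqn0Ngt carry_gt0 mul0r mulr0.
Qed.

End Stickelberger.

(** * Linear factors of the norm form *)

Lemma coef_comp_scaleX (R : comNzRingType) (P : {poly R}) c i :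
  (P \Po (c *: 'X))`_i = c ^+ i * P`_i.
Proof.
rewrite comp_polyE; under eq_bigr => j _ do rewrite exprZn scalerA.
rewrite -(poly_def _ (fun j => P`_j * c ^+ j)) coef_poly [RHS]mulrC.
by case: ltnP => // Pi; rewrite nth_default ?mul0r.
Qed.

Section TorsionFree.

Variable R : comNzRingType.
Hypothesis tfree : forall n (x : R), x *+ n.+1 = 0 -> x = 0.

Lemma mulIr_tfree (k : int) (x y : R) : k != 0 -> k%:~R * x = k%:~R * y -> x = y.
Proof.
move=> k0 /eqP; rewrite -subr_eq0 -mulrBr mulrzl => /eqP kxy.
apply/eqP; rewrite -subr_eq0; apply/eqP.
case: k k0 kxy => [[|k]|k] // _; first exact: tfree.
by rewrite NegzE mulrNz => /eqP; rewrite oppr_eq0 => /eqP; apply: tfree.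
Qed.

Variables (q : nat) (w : R).
Hypotheses (q_prime : prime q) (w_sum : \sum_(i < q) w ^+ i = 0).

Let w_q : w ^+ q = 1 := expr_sum0 w_sum.

(** Viewed as a polynomial in [a], the product is unchanged when [a] is replaced
    by [w * a], which kills all coefficients but the extreme ones. *)
Lemma prod_sub_exp (a b : R) : \prod_(x : 'F_q) (a - b * w ^+ x) = a ^+ q - b ^+ q.
Proof.
pose Q : {poly R} := \prod_(x : 'F_q) ('X - (b * w ^+ x)%:P).
have -> : \prod_(x : 'F_q) (a - b * w ^+ x) = Q.[a].
  by rewrite horner_prod; apply: eq_bigr => x _; rewrite !hornerE.
have Qw : Q \Po (w *: 'X) = Q.
  rewrite rmorph_prod /=.
  transitivity (\prod_(x : 'F_q) (w%:P * ('X - (b * w ^+ (x - 1)%R)%:P))).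
    apply: eq_bigr => x _; rewrite rmorphB /= comp_polyX comp_polyC -mul_polyC.
    have -> : w ^+ x = w * w ^+ (x - 1)%R.
      by rewrite -{1}(subrK 1 x) expr_FpD // mulrC.
    by rewrite !polyCM; ring.
  rewrite big_split /= prodr_const card_Fp // -rmorphXn /= w_q mul1r.
  by rewrite [RHS](reindex_inj (addIr (-1))).
have Qi i : (0 < i < q)%N -> Q`_i = 0.
  move=> iq.
  have wQ : w ^+ i * Q`_i = Q`_i.
    by rewrite -{2}Qw coef_comp_scaleX.
  have wjQ j : (w ^+ i) ^+ j * Q`_i = Q`_i.
    by elim: j => [|j IHj]; rewrite ?mul1r // exprSr -mulrA wQ.
  apply: (@tfree q.-1); rewrite prednK ?prime_gt0 //.
  have : (\sum_(j < q) (w ^+ i) ^+ j) * Q`_i = 0.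
    by rewrite sum_exprX0 ?mul0r // gtnNdvd //; lia.
  rewrite mulr_suml; under eq_bigr => j _ do rewrite wjQ.
  by rewrite sumr_const card_ord.
have sQ : size Q = q.+1.
  by rewrite size_prod_XsubC [index_enum _]unlock -enumT -cardT card_Fp.
have Qmonic : Q`_q = 1.
  have : Q \is monic by apply: monic_prod_XsubC.
  by rewrite monicE lead_coefE sQ => /eqP.
have QE x : Q.[x] = Q`_0 + x ^+ q.
  rewrite horner_coef sQ big_ord_recr /= Qmonic mul1r; congr (_ + _).
  rewrite -(big_mkord xpredT (fun i => Q`_i * x ^+ i)) big_ltn ?prime_gt0 //.
  by rewrite expr0 mulr1 big_nat big1 ?addr0 // => i /Qi ->; rewrite mul0r.
have Qb : Q.[b] = 0.
  by rewrite horner_prod (bigD1 (0 : 'F_q)) //= !hornerE subrr mul0r.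
by rewrite QE; move: Qb; rewrite QE => /eqP; rewrite addr_eq0 => /eqP ->; rewrite addrC.
Qed.

(** The homogeneous cyclotomic form is the norm of [m - n * w]. *)
Lemma prod_norm_form (m n : int) : m != n ->
  \prod_(x : 'F_q | x != 0) (m%:~R - n%:~R * w ^+ x)
  = (\sum_(i < q) m ^+ i * n ^+ (q - 1 - i))%:~R.
Proof.
move=> mn; apply: (@mulIr_tfree (m - n)); first by rewrite subr_eq0.
transitivity (m%:~R ^+ q - n%:~R ^+ q : R).
  by rewrite -prod_sub_exp [RHS](bigD1 (0 : 'F_q)) //= mulr1 rmorphB.
rewrite -!rmorphXn -rmorphB -rmorphM /=; congr (_%:~R).
rewrite -opprB subrXX -mulNr opprB; congr (_ * _); apply: eq_bigr => i _.
by rewrite mulrC subn1.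
Qed.

End TorsionFree.

(** * The factorization of the Gauss sum *)

Section GlobalEquation.

Variables (p q f : nat).
Hypotheses (p_prime : prime p) (q_prime : prime q) (q_odd : odd q).
Hypothesis p_qf : (p.-1 = q * f)%N.
Variable r : 'F_p.
Hypothesis r_prim : q.-primitive_root r.
Variable ind : 'F_p -> nat.
Hypotheses (r_ind : forall x, x != 0 -> r ^+ ind x = x ^+ f)
  (indM : forall x y, x != 0 -> y != 0 -> ind (x * y) = (ind x + ind y)%N %[mod q])
  (ind_onto : exists2 v, v != 0 & ind v = 1%N %[mod q]).
Variables (m n : int) (inv : nat -> nat).
Hypotheses (mn : m != n) (m_nr : m%:~R = n%:~R * r :> 'F_p)
  (p_def : p%:Z = \sum_(i < q) m ^+ i * n ^+ (q - 1 - i))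
  (invE : forall t, (0 < t < q)%N -> (t * inv t)%N = 1%N %[mod q]).

(** The [q]-th power of the Gauss sum, as a polynomial in the root of unity. *)
Definition gauss_poly : {poly int} := p%:R * \prod_(1 <= j < q.-1) jacobi_poly ind j.

Let lin t : {poly int} := linear_poly m n \Po 'X^(inv t).

Let q_gt0 : (0 < q)%N := prime_gt0 q_prime.
Let q_gt2 : (2 < q)%N. Proof. by rewrite odd_prime_gt2. Qed.

(** By [jacobi_poly_dvd] each further Jacobi sum brings one factor [p], at the cost
    of [carry t j] linear factors of index [t]; the exponent [t * k %/ q] is the
    total of these carries for [j < k]. *)
Lemma prod_jacobi_dvd k : (0 < k < q)%N -> exists R M,
  \prod_(1 <= j < k) jacobi_poly ind j * \prod_(1 <= t < q) lin t ^+ (t * k %/ q)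
  = p%:R ^+ k.-1 * R + geom _ q * M.
Proof.
case: k => // k; elim: k => [|k IHk] kq.
  exists 1, 0; rewrite big_geq // !mul1r mulr0 addr0 big_nat big1 // => t tq.
  by rewrite muln1 divn_small //; case/andP: tq.
have [|R1 [M1 e1]] := IHk; first by lia.
have [|R2 [M2 e2]] := @jacobi_poly_dvd _ _ _ p_prime q_prime p_qf _ r_prim
  _ r_ind _ _ _ m_nr invE k.+1; first by lia.
exists (R1 * R2), (p%:R ^+ k * R1 * M2 + M1 * (p%:R * R2 + geom _ q * M2)).
transitivity ((p%:R ^+ k * R1 + geom int q * M1) * (p%:R * R2 + geom _ q * M2)).
  rewrite -e1 -e2 [in LHS]big_nat_recr //= mulrACA -big_split /=; congr (_ * _).
  apply: eq_bigr => t _; rewrite -exprD /carry subnKC //.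
  by rewrite leq_div2r // leq_mul2l leqnSn orbT.
by rewrite /= exprS; ring.
Qed.

Section Model.

Variables (R : comNzRingType) (w z : R).
Hypotheses (w_sum : \sum_(i < q) w ^+ i = 0) (z_sum : \sum_(s < p) z ^+ s = 0).
Hypothesis tfree : forall k (x : R), x *+ k.+1 = 0 -> x = 0.

Lemma evz_gauss_poly : evz w gauss_poly = gauss_sum z ind w ^+ q.
Proof.
rewrite gauss_sum_expq // rmorphM rmorph_prod rmorph_nat /=; congr (_ * _).
by apply: eq_bigr => j _; rewrite evz_jacobi_poly.
Qed.

Let w_q : w ^+ q = 1 := expr_sum0 w_sum.

Let natr_val (x : 'F_q) : (x : nat)%:R = x. Proof. exact: natr_Zp. Qed.

Let val_range (x : 'F_q) : x != 0 -> (0 < x < q)%N.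
Proof.
move=> x0; have := ltn_ord x; rewrite [X in (_ < X)%N]Fp_cast // => ->.
by rewrite lt0n andbT.
Qed.

Let val_oppr (x : 'F_q) : x != 0 -> ((- x)%R + x)%N = q.
Proof.
move=> x0; have := val_range x0; have : - x != 0 by rewrite oppr_eq0.
move/val_range; set y := nat_of_ord (- x) => yq xq.
have /dvdnP[k yx] : (q %| y + x)%N.
  by rewrite -Fp_natr_eq0 // natrD !natr_val addNr.
by rewrite yx; case: k yx => [|[|k]] yx; [lia|rewrite mul1n|nia].
Qed.

Let lam (u : R) (x : 'F_q) : R := m%:~R - n%:~R * u ^+ (x^-1)%R.

Let evz_lin u (t : nat) : u ^+ q = 1 -> (0 < t < q)%N -> evz u (lin t) = lam u t%:R.
Proof.
move=> uq tq; rewrite /lin evz_comp_Xn evz_linear_poly /lam; congr (_ - _ * _).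
rewrite -(expr_Fp_nat (inv t) q_prime uq); congr (_ ^+ _).
have t0 : t%:R != 0 :> 'F_q by rewrite Fp_natr_eq0 // gtnNdvd //; lia.
congr nat_of_ord; apply: (mulfI t0); rewrite mulfV // -natrM.
have [y] := rcong_nat 'F_q (invE tq).
by rewrite pchar_Fp_0 // mul0r => /eqP; rewrite subr_eq0 => /eqP.
Qed.

Let evz_lin_prod u (e : nat -> nat) : u ^+ q = 1 ->
  \prod_(1 <= t < q) evz u (lin t) ^+ e t = \prod_(x : 'F_q | x != 0) lam u x ^+ e x.
Proof.
move=> uq; rewrite -(big_Fp_neq0 _ (fun t => evz u (lin t) ^+ e t)) //.
by apply: eq_bigr => x x0; rewrite evz_lin ?natr_val // val_range.
Qed.

Let prod_lam : \prod_(x : 'F_q | x != 0) lam w x = p%:R.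
Proof.
have <- : p%:~R = p%:R :> R by rewrite -pmulrn.
rewrite p_def -(prod_norm_form tfree q_prime w_sum mn) (reindex_inj invr_inj) /=.
by apply: eq_big => [x|x _]; rewrite ?invr_eq0 // /lam invrK.
Qed.

Lemma evz_lin_prod1 : \prod_(1 <= t < q) evz w (lin t) = p%:R.
Proof.
rewrite -prod_lam; have := evz_lin_prod (fun=> 1%N) w_q.
by under eq_bigr => t _ do rewrite expr1; under [X in _ = X -> _]eq_bigr => t _ do rewrite expr1.
Qed.

Let lam_conj x : lam (w ^+ q.-1) x = lam w (- x).
Proof.
rewrite /lam invrN -exprM; congr (_ - _ * _); set y := x^-1.
have -> : - y = (q.-1%:R * y : 'F_q).
  by rewrite -subn1 natrB ?prime_gt0 // pchar_Fp_0 // sub0r mulN1r.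
by rewrite expr_FpM // [RHS]exprM expr_Fp_nat // -exprM.
Qed.

(** Complex conjugation exchanges the factors of index [t] and [q - t]. *)
Lemma evz_lin_conj :
  \prod_(1 <= t < q) evz w (lin t) ^+ t
  * \prod_(1 <= t < q) evz (w ^+ q.-1) (lin t) ^+ t = p%:R ^+ q.
Proof.
rewrite (evz_lin_prod id w_q) (evz_lin_prod id); last first.
  by rewrite exprAC w_q expr1n.
rewrite [X in _ * X](reindex_inj oppr_inj) /=.
under [X in _ * X]eq_big => [x|x _] do [rewrite oppr_eq0|rewrite lam_conj opprK].
rewrite -big_split -prod_lam -prodrXl /=; apply: eq_bigr => x x0.
by rewrite -exprD addnC val_oppr.
Qed.

End Model.

(** The quotient [U] of the left-hand side by [p ^ q] is a cyclotomic integer by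
    [prod_jacobi_dvd].  Both the Gauss sum and the product of linear factors have
    an absolute value that is a power of [p], so that of [U] is 1 and
    [unit_circle_geom] applies. *)
Lemma gauss_poly_factor : exists (e : int) k N, e ^+ 2 = 1 /\
  gauss_poly * \prod_(1 <= t < q) lin t ^+ t
  = e%:P * p%:R ^+ q * 'X^k + geom _ q * N.
Proof.
have [R [w [z [w_sum z_sum tfree model]]]] :=
  cyclotomic_model (prime_gt1 p_prime) (prime_gt1 q_prime).
have w_q := expr_sum0 w_sum.
have lift P Q : evz w P = evz w Q -> exists N, P = Q + geom _ q * N.
  move=> PQ; have [|M [N PQN]] := model (P - Q) 0 0.
    by rewrite rmorphB /= PQ subrr mulr0.
  by exists N; rewrite -[P](subrK Q) PQN mul0r add0r addrC.
have wV_sum : \sum_(i < q) (w ^+ q.-1) ^+ i = 0.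
  by apply: sum_exprX0 => //; rewrite gtnNdvd //; lia.
have [U [N1 AU]] : exists U N,
    gauss_poly * \prod_(1 <= t < q) lin t ^+ t = p%:R ^+ q * U + geom _ q * N.
  have [|U [M eU]] := @prod_jacobi_dvd q.-1; first by lia.
  exists U; apply: lift.
  have -> : \prod_(1 <= t < q) lin t ^+ t
      = \prod_(1 <= t < q) lin t ^+ (t * q.-1 %/ q) * \prod_(1 <= t < q) lin t.
    rewrite -big_split big_nat [RHS]big_nat; apply: eq_bigr => t tq.
    rewrite /= -exprSr; congr (_ ^+ _); case: t tq => // t tq.
    (* For [0 < t < q] the carries of [t] over all [j] add up to [t - 1]. *)
    have -> : (t.+1 * q.-1 = t * q + (q - t.+1))%N by nia.
    by rewrite divnMDl // divn_small ?addn0 //; lia.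
  rewrite /gauss_poly mulrA -[p%:R * _ * _]mulrA eU.
  rewrite !(rmorphM, rmorphD) /= evz_geom w_sum mul0r addr0 rmorph_prod /=.
  rewrite (evz_lin_prod1 w_sum tfree) !rmorphXn !rmorph_nat.
  have -> : p%:R ^+ q = p%:R * p%:R ^+ q.-2 * p%:R :> R.
    by rewrite mulrAC -expr2 -exprD; congr (_ ^+ _); lia.
  by ring.
have UU : evz w (U * (U \Po 'X^(q.-1))) = evz w 1.
  (* Valid for [w] and for its inverse [w ^+ q.-1], the complex conjugate. *)
  have ev u : \sum_(i < q) u ^+ i = 0 ->
      p%:R ^+ q * evz u U = gauss_sum z ind u ^+ q * \prod_(1 <= t < q) evz u (lin t) ^+ t.
    move=> u_sum; rewrite -evz_gauss_poly //; move: gauss_poly AU => g AU.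
    have := congr1 (evz u) AU; rewrite !(rmorphM, rmorphD) /= evz_geom u_sum mul0r addr0.
    rewrite (rmorphXn (evz u)) (rmorph_nat (evz u) p) => <-; rewrite rmorph_prod; congr (_ * _).
    by apply: eq_bigr => t _; rewrite rmorphXn.
  have pZ : p%:R = p%:~R :> R by rewrite -pmulrn.
  apply: (@mulIr_tfree _ tfree ((p%:Z ^+ q) ^+ 2)).
    by rewrite !expf_neq0 // eqz_nat -lt0n prime_gt0.
  rewrite !rmorphXn /= -pZ rmorph1 mulr1 rmorphM /= evz_comp_Xn.
  rewrite expr2.
  have -> : p%:R ^+ q * p%:R ^+ q * (evz w U * evz (w ^+ q.-1) U)
    = (p%:R ^+ q * evz w U) * (p%:R ^+ q * evz (w ^+ q.-1) U) by ring.
  rewrite !ev // mulrACA evz_lin_conj // -exprMn (@gauss_sumV _ _ q) //.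
  by rewrite -exprS prednK.
have [N2 UN] := lift _ _ UU.
have [e [k [N3 [e2 UE]]]] := unit_circle_geom q_prime UN.
exists e, k, (p%:R ^+ q * N3 + N1); split=> //.
by rewrite AU UE; ring.
Qed.

(** [gauss_sum_rcong], descended from the ring that contains the [p]-th roots of
    unity to integral polynomials. *)
Lemma gauss_poly_lam : p != q -> exists M N,
  - gauss_poly = 1 - (ind q%:R)%:R * ('X - 1) ^+ q + ('X - 1) ^+ q.+1 * M + geom _ q * N.
Proof.
move=> pq.
have [R [w [z [w_sum z_sum tfree model]]]] :=
  cyclotomic_model (prime_gt1 p_prime) (prime_gt1 q_prime).
have [y] := gauss_sum_rcong p_prime q_prime q_odd z_sum indM w_sum pq.
rewrite -evz_gauss_poly //; move: gauss_poly => g gy.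
have evY : evz w ('X - 1) = w - 1 by rewrite rmorphB /= evzX rmorph1.
have [|M [N MN]] := model (- g - (1 - (ind q%:R)%:R * ('X - 1) ^+ q))
    (('X - 1) ^+ q.+1) y.
  rewrite rmorphB rmorphN rmorphB rmorph1 rmorphM !rmorphXn rmorph_nat /=.
  by rewrite evY gy.
by exists M, N; rewrite -addrA -MN; ring.
Qed.

End GlobalEquation.

(** * Polylogarithms of negative index *)

Lemma map_logder_num (R S : comNzRingType) (f : {rmorphism R -> S}) P k :
  map_poly f (logder_num P k) = logder_num (map_poly f P) k.
Proof.
have mapE (Q : {poly R}) : map_poly f (eulerD Q) = eulerD (map_poly f Q).
  by rewrite /eulerD rmorphM /= map_polyX deriv_map.
elim: k => [|k IHk] /=; first exact: mapE.
rewrite rmorphB rmorphM [in X in _ - X]rmorphM [in X in _ - X * _]rmorphM rmorph_nat /=.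
by rewrite !mapE IHk.
Qed.

Section Polylog.

Variable F : fieldType.

(** The numerator of [Li_{-k}] over the denominator [(1 - X) ^ (k + 1)]. *)
Fixpoint polylog_num k : {poly F} :=
  if k is k'.+1 then (1 - 'X) * eulerD (polylog_num k') + k'.+1%:R * 'X * polylog_num k'
  else 'X.

Lemma neg_polylogE k :
  neg_polylog F k = (polylog_num k)%:F / ((1 - 'X) ^+ k.+1)%:F.
Proof.
have X1 : 1 - 'X != 0 :> {poly F} by rewrite -opprB oppr_eq0 -polyC1 polyXsubC_eq0.
elim: k => [|k IHk]; first by rewrite expr1.
rewrite /neg_polylog iterS -/(neg_polylog F k) IHk /theta fderivE ?expf_neq0 //.
rewrite mulrA -tofracM; apply/eqP.
rewrite eqr_div ?tofrac_eq0 ?expf_neq0 // -!tofracM tofrac_eq; apply/eqP.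
rewrite deriv_exp derivB -polyC1 derivC derivX polyC1 sub0r /= /eulerD -mulr_natl.
by rewrite !exprS; ring.
Qed.

(** The Euler derivatives of [log (m - n * X)] at 1 and those of [log (1 - X)] at
    [n / m] agree, because the Euler operator commutes with scaling [X]. *)
Lemma logder_num_linear (a x : F) k :
  logder_num (a%:P * (1 - x *: 'X)) k = - a%:P ^+ k.+1 * (polylog_num k \Po (x *: 'X)).
Proof.
have Dcomp (Q : {poly F}) : eulerD (Q \Po (x *: 'X)) = eulerD Q \Po (x *: 'X).
  rewrite /eulerD deriv_comp derivZ derivX comp_polyM comp_polyX -!mul_polyC; ring.
have DP : eulerD (a%:P * (1 - x *: 'X)) = - a%:P * (x *: 'X).
  rewrite eulerDM eulerDC mul0r add0r /eulerD derivB -polyC1 derivC derivZ derivX.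
  by rewrite -!mul_polyC; ring.
elim: k => [|k IHk] /=; first by rewrite DP comp_polyX expr1.
have Dc : eulerD (- a%:P ^+ k.+1) = 0 by rewrite -polyC_exp -polyCN eulerDC.
rewrite IHk eulerDM Dc mul0r add0r Dcomp DP.
rewrite comp_polyD !comp_polyM comp_polyB comp_polyX -polyC1 -polyC_natr !comp_polyC.
by rewrite !exprS; ring.
Qed.

End Polylog.

Lemma fhorner_neg_polylog (m n : int) k : m != 0 -> m != n ->
  fhorner (neg_polylog rat k) (n%:~R / m%:~R)
  = - (logder_num (linear_poly m n) k).[1]%:~R / (m - n)%:~R ^+ k.+1.
Proof.
move=> m0 mn; have m0' : m%:~R != 0 :> rat by rewrite intr_eq0.
have mn0 : (m - n)%:~R != 0 :> rat by rewrite intr_eq0 subr_eq0.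
set x := n%:~R / m%:~R : rat.
have mx : m%:~R * (1 - x) = (m - n)%:~R by rewrite /x rmorphB /=; field.
have x1 : 1 - x != 0 by apply: contraNneq mn0 => x1; rewrite -mx x1 mulr0.
rewrite neg_polylogE fhornerE; last by rewrite horner_exp !hornerE expf_neq0.
rewrite horner_exp !hornerE -mx.
have -> : (logder_num (linear_poly m n) k).[1]%:~R
        = - m%:~R ^+ k.+1 * (polylog_num rat k).[x].
  have <- : (map_poly intr (logder_num (linear_poly m n) k)).[1]
          = (logder_num (linear_poly m n) k).[1]%:~R :> rat.
    by rewrite -[1 in LHS](rmorph1 intr) horner_map.
  rewrite map_logder_num.
  have -> : map_poly intr (linear_poly m n) = (m%:~R)%:P * (1 - x *: 'X) :> {poly rat}.
    rewrite rmorphB rmorphM /= !map_polyC map_polyX /= -mul_polyC mulrBr mulr1.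
    by rewrite mulrA -polyCM; congr (_ - _%:P * _); rewrite /x; field.
  rewrite logder_num_linear hornerM hornerN horner_exp hornerC horner_comp.
  by rewrite hornerZ hornerX mulr1.
by rewrite exprMn; field; rewrite !expf_neq0.
Qed.

(** * The criterion modulo q squared *)

Lemma intr_Zp_eq0 N (a : int) : (1 < N)%N -> (a%:~R == 0 :> 'Z_N) = (N%:Z %| a)%Z.
Proof.
move=> N_gt1; have natZ b : (b%:R == 0 :> 'Z_N) = (N %| b)%N.
  by rewrite -val_eqE /= val_Zp_nat.
case: a => b; first exact: natZ.
by rewrite NegzE mulrNz oppr_eq0 dvdzE abszN natZ.
Qed.

Section LocalCriterion.

Variables (p q c : nat) (m n : int) (inv : nat -> nat).
Hypotheses (q_prime : prime q) (q_odd : odd q) (p_prime : prime p) (p_neq_q : p != q).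
Hypothesis mn : ~~ (q%:Z %| m - n)%Z.
Hypothesis invE : forall t, (0 < t < q)%N -> (t * inv t)%N = 1%N %[mod q].
Variables (G M N N' : {poly int}) (e : int) (k : nat).
Hypothesis e2 : e ^+ 2 = 1.
Hypothesis G_factor :
  G * \prod_(1 <= t < q) (linear_poly m n \Po 'X^(inv t)) ^+ t
  = e%:P * p%:R ^+ q * 'X^k + geom _ q * N'.
Hypothesis G_lam :
  - G = 1 - c%:R * ('X - 1) ^+ q + ('X - 1) ^+ q.+1 * M + geom _ q * N.

Let A := 'Z_(q ^ 2).

Let q_gt0 : (0 < q)%N := prime_gt0 q_prime.

Let q2_gt1 : (1 < q ^ 2)%N.
Proof. by rewrite -{1}(exp1n 2) ltn_exp2r // prime_gt1. Qed.

Let q2_eq0 : q%:R * q%:R = 0 :> A.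
Proof. by rewrite -natrM mulnn; apply/eqP; rewrite pmulrn intr_Zp_eq0. Qed.

Let unitA (a : int) : ~~ (q%:Z %| a)%Z -> exists b : A, a%:~R * b = 1.
Proof.
move=> qa; have /coprimezP[[u v] /= uv] : coprimez a (q ^ 2)%N.
  by rewrite coprimezE /= coprimeXr // coprime_sym prime_coprime // -dvdzE.
exists u%:~R; rewrite -rmorphM /= mulrC -[1](rmorph1 intr).
apply/eqP; rewrite -subr_eq0 -rmorphB intr_Zp_eq0 //= -uv opprD addrA subrr sub0r.
by rewrite -mulNr dvdz_mull.
Qed.

Let mulI_unit (a : int) (x : A) : ~~ (q%:Z %| a)%Z -> a%:~R * x = 0 -> x = 0.
Proof.
by move=> /unitA[b ab] ax; rewrite -[x]mul1r -ab mulrAC ax mul0r.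
Qed.

Let phi : {poly int} -> {poly A} := map_poly intr.

(** Apply [logder] to both sides of [G_factor]: the right-hand side contributes 0,
    the factor [G] contributes [- c * q!] by [G_lam], and the linear factors are
    obtained from a single one by substitutions ['X^s]. *)
Lemma logder_relation : exists2 ell : A,
  ell * (m - n)%:~R ^+ q = (logder_num (linear_poly m n) q.-1).[1]%:~R &
  c%:R * q`!%:R = (\sum_(1 <= t < q) t * inv t ^ q)%N%:R * ell.
Proof.
have q_gt2 : (2 < q)%N by rewrite odd_prime_gt2.
have L1 : (phi (linear_poly m n)).[1] = (m - n)%:~R.
  by rewrite -[1 in LHS](rmorph1 intr) horner_map /= /linear_poly !hornerE.
have [b ab] := unitA mn.
have [|ell Lell] := @logder_exists A q (phi (linear_poly m n)) b.
  by rewrite L1.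
exists ell.
  have := logder_numE q_prime q_odd Lell; rewrite L1 => ->.
  by rewrite -map_logder_num -[1 in LHS](rmorph1 intr) horner_map.
have LG : logder q (phi G) (- c%:R * q`!%:R).
  have -> : phi G = (-1)%:P * phi (- G) by rewrite /phi [map_poly _ (- G)]rmorphN polyCN mulN1r opprK.
  rewrite -[X in logder _ _ X]add0r; apply: logderM => //.
    by apply: (@logderC _ _ _ (-1)); rewrite mulrNN mulr1.
  rewrite G_lam /phi rmorphD /= [X in _ + X]rmorphM /= map_geom.
  have P1 : (map_poly intr (1 - c%:R * ('X - 1) ^+ q + ('X - 1) ^+ q.+1 * M)
      : {poly A}).[1] * 1 = 1.
    rewrite mulr1 -[1 in LHS](rmorph1 intr) horner_map /= !hornerE.
    by rewrite subrr !expr0n [q == 0%N]eqn0Ngt q_gt0 /= mulr0 mul0r subr0 addr0.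
  apply: (logder_geom q_prime q_odd q2_eq0 _ P1).
  rewrite rmorphD rmorphB rmorph1 !rmorphM !rmorphXn rmorphB /= map_polyX rmorph1 rmorph_nat.
  apply: (logder_rcong q_prime _ (logder_1subYq q_prime c%:R)).
  rewrite polyC_natr; exists (- phi M).
  by rewrite /phi; ring.
have LP : logder q (phi (G * \prod_(1 <= t < q) (linear_poly m n \Po 'X^(inv t)) ^+ t))
    (- c%:R * q`!%:R + \sum_(1 <= t < q) t%:R * ((inv t)%:R ^+ q * ell)).
  rewrite /phi rmorphM rmorph_prod; apply: logderM => //.
  apply: logder_prod => // t _; rewrite rmorphXn; apply: logderX => //.
  by rewrite /= map_comp_poly map_polyXn; apply: logder_comp_Xn.
have LR : logder q (phi (e%:P * p%:R ^+ q * 'X^k + geom _ q * N')) 0.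
  rewrite /phi rmorphD [X in _ + X]rmorphM /= map_geom.
  have [|d pd] := @unitA (p%:Z ^+ q).
    rewrite dvdzE abszX Euclid_dvdX // negb_and dvdn_prime2 //.
    by rewrite eq_sym (negPf p_neq_q).
  have eE : map_poly intr (e%:P * p%:R ^+ q) = (e%:~R * (p%:Z ^+ q)%:~R)%:P :> {poly A}.
    by rewrite rmorphM rmorphXn rmorph_nat /= map_polyC polyCM !rmorphXn /= -polyC_natr.
  have eU : (e%:~R * (p%:Z ^+ q)%:~R) * (e%:~R * d) = 1 :> A.
    by rewrite mulrACA pd mulr1 -rmorphM -expr2 e2.
  apply: (@logder_geom _ _ _ _ _ _ _ (e%:~R * d)) => //.
    by rewrite rmorphM /= eE map_polyXn hornerM hornerC hornerXn expr1n mulr1.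
  rewrite rmorphM /= eE map_polyXn -[0]addr0; apply: logderM => //.
    exact: logderC eU.
  by rewrite -(mulr0 k%:R); apply: logderX => //; apply: logder_X.
rewrite G_factor in LP; have := logder_uniq q_prime LP LR.
move/eqP; rewrite addrC mulNr subr_eq0 => /eqP <-.
rewrite natr_sum mulr_suml; apply: eq_bigr => t _.
by rewrite natrM natrX mulrA.
Qed.

Lemma local_criterion :
  (q%:Z ^+ 2 %| (logder_num (linear_poly m n) q.-1).[1])%Z <-> (q %| c)%N.
Proof.
have [ell hH hc] := logder_relation.
set H := _.[1] in hH *; set kappa := (\sum_(1 <= t < q) _)%N in hc.
(* Each term is 1 modulo [q], so [kappa] is [-1] modulo [q]. *)
have kq : ~~ (q%:Z %| kappa%:Z)%Z.
  rewrite dvdzE /= -Fp_natr_eq0 // natr_sum big_nat.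
  under eq_bigr => t tq.
    have -> : (t * inv t ^ q)%:R = 1 :> 'F_q.
      have inv_q : ((inv t)%:R : 'F_q) ^+ q = (inv t)%:R.
        have [y] := fermat_rcong 'F_q q_prime (inv t).
        by rewrite pchar_Fp_0 // mul0r => /eqP; rewrite subr_eq0 => /eqP.
      rewrite natrM natrX inv_q -natrM; have [y] := rcong_nat 'F_q (invE tq).
      by rewrite pchar_Fp_0 // mul0r => /eqP; rewrite subr_eq0 => /eqP.
    over.
  by rewrite -big_nat sumr_const_nat natrB // pchar_Fp_0 // sub0r oppr_eq0 oner_eq0.
(* [q`!] is [q] times the unit [(q - 1)`!]. *)
have cq : (c%:R * q`!%:R == 0 :> A) = (q %| c)%N.
  rewrite -natrM pmulrn intr_Zp_eq0 // dvdzE /= -mulnn -{3}(prednK q_gt0) factS.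
  rewrite prednK // mulnCA dvdn_pmul2l // Gauss_dvdl // prime_coprime //.
  have := Wilson (prime_gt1 q_prime); rewrite q_prime => /esym qW.
  apply/negP => qF; move: qW; rewrite -addn1 dvdn_addr // dvdn1.
  by move=> /eqP q1; move: q_prime; rewrite q1.
have -> : (q%:Z ^+ 2 %| H)%Z = (H%:~R == 0 :> A).
  by rewrite intr_Zp_eq0 // -natrX -pmulrn natz.
rewrite -cq; split=> [/eqP H0|/eqP c0].
  suff ell0 : ell = 0 by rewrite hc ell0 mulr0.
  apply: (@mulI_unit ((m - n) ^+ q)); last by rewrite rmorphXn mulrC hH.
  by rewrite dvdzE abszX Euclid_dvdX // negb_and mn.
have ell0 : ell = 0 by apply: (mulI_unit kq); rewrite -pmulrn -hc.
by rewrite -hH ell0 mul0r.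
Qed.

End LocalCriterion.

(** * Residue symbols and the main equivalence *)

Lemma dvdz_Fp p (a : int) : prime p -> (p%:Z %| a)%Z = (a%:~R == 0 :> 'F_p).
Proof. by move=> p_pr; rewrite -(dvdz_pcharf (pchar_Fp p_pr)). Qed.

Section Setup.

Variables (q p : nat) (m n : int).
Hypotheses (q_ge3 : (3 <= q)%N) (p_prime : prime p)
  (p_def : p%:Z = \sum_(i < q) m ^+ i * n ^+ (q - 1 - i)).

Let subXX : m ^+ q - n ^+ q = (m - n) * p%:Z.
Proof.
rewrite -opprB subrXX -mulNr opprB p_def; congr (_ * _).
by apply: eq_bigr => i _; rewrite mulrC subn1.
Qed.

(** Otherwise [p] also divides [m], and its square divides the form, which is
    homogeneous of degree at least 2. *)
Lemma p_ndvd_n : n%:~R != 0 :> 'F_p.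
Proof.
apply/eqP => n0; have q_gt0 : (0 < q)%N by lia.
have m0 : m%:~R = 0 :> 'F_p.
  have := congr1 (fun a : int => a%:~R : 'F_p) subXX.
  rewrite rmorphB rmorphM !rmorphXn /= n0 expr0n eqn0Ngt q_gt0 subr0.
  rewrite -[(p%:Z)%:~R]/(p%:R) pchar_Fp_0 // mulr0 => /eqP.
  by rewrite expf_eq0 q_gt0 => /eqP.
have dvdXX (a : int) : a%:~R = 0 :> 'F_p -> exists b, a = p%:Z * b.
  by move/eqP; rewrite -dvdz_Fp // => /dvdzP[b ->]; exists b; rewrite mulrC.
have [[a ma] [b nb]] := (dvdXX _ m0, dvdXX _ n0).
have : (p%:Z ^+ 2 %| p%:Z)%Z.
  rewrite {1}p_def; apply: rpred_sum => i _.
  have -> : m ^+ i * n ^+ (q - 1 - i) = p%:Z ^+ (q - 1) * (a ^+ i * b ^+ (q - 1 - i)).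
    rewrite ma nb !exprMn mulrACA -exprD subnKC //.
    by have := ltn_ord i; lia.
  by apply: dvdz_mulr; apply: dvdz_exp2l; lia.
rewrite dvdzE abszX /= => /dvdn_leq -/(_ (prime_gt0 p_prime)).
by have := prime_gt1 p_prime; nia.
Qed.

Let r : 'F_p := m%:~R / n%:~R.

Lemma m_eq_nr : m%:~R = n%:~R * r :> 'F_p.
Proof. by rewrite /r mulrC divfK // p_ndvd_n. Qed.

Hypotheses (q_prime : prime q) (p_neq_q : p != q).

Lemma ratio_primitive : q.-primitive_root r.
Proof.
have n0 := p_ndvd_n; have q_gt0 : (0 < q)%N by lia.
have r_q : r ^+ q = 1.
  have : m%:~R ^+ q - n%:~R ^+ q = 0 :> 'F_p.
    rewrite -!rmorphXn -rmorphB subXX rmorphM /=.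
    by rewrite -[(p%:Z)%:~R]/(p%:R) pchar_Fp_0 // mulr0.
  rewrite m_eq_nr exprMn -{2}[_ ^+ q]mulr1 -mulrBr => /eqP.
  by rewrite mulf_eq0 expf_eq0 (negPf n0) andbF subr_eq0 => /eqP.
have [d dr dq] := prim_order_exists q_gt0 r_q.
have /primeP[_ /(_ d dq)/orP[]/eqP dE] := q_prime; last by rewrite -dE.
have r1 : r = 1 by have := prim_expr_order dr; rewrite dE expr1.
have mn : m%:~R = n%:~R :> 'F_p by rewrite m_eq_nr r1 mulr1.
have : p%:R = q%:R * n%:~R ^+ (q - 1) :> 'F_p.
  rewrite -[p%:R]/((p%:Z)%:~R) p_def rmorph_sum /=.
  under eq_bigr => i _.
    rewrite rmorphM !rmorphXn /= mn -exprD subnKC; last by have := ltn_ord i; lia.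
    over.
  by rewrite sumr_const card_ord mulr_natl.
rewrite pchar_Fp_0 // => /eqP; rewrite eq_sym mulf_eq0 expf_eq0 (negPf n0) andbF orbF.
by rewrite Fp_natr_eq0 // dvdn_prime2 // (negPf p_neq_q).
Qed.

(** If [m] and [n] agree modulo [q], the [q] terms of the form are equal modulo
    [q], and [q] divides [p]. *)
Lemma q_ndvd_sub : ~~ (q%:Z %| m - n)%Z.
Proof.
apply/negP; rewrite dvdz_Fp // rmorphB subr_eq0 => /eqP mn.
have : p%:R = q%:R * n%:~R ^+ (q - 1) :> 'F_q.
  rewrite -[p%:R]/((p%:Z)%:~R) p_def rmorph_sum /=.
  under eq_bigr => i _.
    rewrite rmorphM !rmorphXn /= mn -exprD subnKC; last by have := ltn_ord i; lia.
    over.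
  by rewrite sumr_const card_ord mulr_natl.
rewrite pchar_Fp_0 // mul0r => /eqP; rewrite Fp_natr_eq0 // dvdn_prime2 //.
by rewrite eq_sym (negPf p_neq_q).
Qed.

End Setup.

Lemma primitive_root_Fp p : prime p -> exists g : 'F_p, p.-1.-primitive_root g.
Proof.
move=> p_pr.
have : has p.-1.-primitive_root (enum (predC1 (0 : 'F_p))).
  apply: has_prim_root; rewrite ?enum_uniq //.
  - by have := prime_gt1 p_pr; lia.
  - apply/allP => x; rewrite mem_enum unity_rootE => x0.
    by rewrite Fp_expf_pred.
  by rewrite -cardE cardC1 card_Fp.
by case/hasP => g _; exists g.
Qed.

(** The [q]-th powers are the kernel of [x |-> x ^+ f], whose image is generated
    by [r]; a discrete logarithm for this image is a character of order [q]. *)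
Lemma residue_index p q f (r : 'F_p) : prime p -> prime q -> (p.-1 = q * f)%N ->
    q.-primitive_root r ->
  exists ind : 'F_p -> nat,
  [/\ forall x, x != 0 -> r ^+ ind x = x ^+ f,
      forall x y, x != 0 -> y != 0 -> ind (x * y) = (ind x + ind y)%N %[mod q],
      exists2 v, v != 0 & ind v = 1%N %[mod q] &
      forall x, x != 0 -> (q %| ind x)%N <-> exists y, x = y ^+ q].
Proof.
move=> p_pr q_pr pqf r_prim; have [g g_prim] := primitive_root_Fp p_pr.
have p1 := prime_gt1 p_pr.
have q_gt0 := prime_gt0 q_pr.
have f_gt0 : (0 < f)%N by case: (posnP f) pqf => // ->; lia.
have xf x : x != 0 -> (x ^+ f) ^+ q = 1 :> 'F_p.
  by move=> x0; rewrite -exprM mulnC -pqf Fp_expf_pred.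
have g0 : g != 0.
  apply/eqP => g0; have := prim_expr_order g_prim.
  by rewrite g0 expr0n pqf muln_eq0 !eqn0Ngt q_gt0 f_gt0 => /esym/eqP; rewrite oner_eq0.
have log x : x != 0 -> exists k, x = g ^+ k.
  move=> x0; have /(prim_rootP g_prim)[k ->] := Fp_expf_pred p_pr x0.
  by exists k.
have [ind indE] : exists ind : 'F_p -> nat, forall x, x != 0 -> r ^+ ind x = x ^+ f.
  have /choice[ind indE] : forall x : 'F_p, exists i : nat, x != 0 -> r ^+ i = x ^+ f.
    move=> x; have [->|x0] := eqVneq x 0; first by exists 0%N.
    by have [i ->] := prim_rootP r_prim (xf x x0); exists i.
  by exists ind.
exists ind; split=> //.
- move=> x y x0 y0; apply/eqP; rewrite -(eq_prim_root_expr r_prim) exprD !indE //.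
    by rewrite exprMn.
  by rewrite mulf_neq0.
- have r0 : r != 0.
    apply/eqP => r0; have := prim_expr_order r_prim.
    by rewrite r0 expr0n eqn0Ngt q_gt0 => /esym/eqP; rewrite oner_eq0.
  have [b rb] := log r r0.
  have /dvdnP[a ba] : (f %| b)%N.
    rewrite -(@dvdn_pmul2l q) // -pqf (prim_order_dvd g_prim) mulnC exprM -rb.
    by rewrite (prim_expr_order r_prim).
  exists (g ^+ a); first by rewrite expf_neq0.
  apply/eqP; rewrite -(eq_prim_root_expr r_prim) indE ?expf_neq0 //.
  by rewrite -exprM -ba -rb expr1.
move=> x x0; rewrite (prim_order_dvd r_prim) indE //; split=> [xf1|[y xy]].
  have [b xb] := log x x0.
  have /dvdnP[a ba] : (q %| b)%N.
    rewrite -(@dvdn_pmul2r f) // -pqf (prim_order_dvd g_prim) exprM -xb.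
    exact: xf1.
  by exists (g ^+ a); rewrite -exprM -ba.
rewrite xy -exprM -pqf Fp_expf_pred //.
by apply: contraNneq x0 => y0; rewrite xy y0 expr0n eqn0Ngt q_gt0.
Qed.

Lemma power_residue_symbolP q a p : prime p ->
  power_residue_symbol q a p = 1 <-> exists y : 'F_p, a%:~R = y ^+ q.
Proof.
move=> p_pr; rewrite /power_residue_symbol.
have eqF (b : int) : (a = b ^+ q %[mod p%:Z])%Z <-> a%:~R = b%:~R ^+ q :> 'F_p.
  split=> [/eqP|e].
    by rewrite eqz_mod_dvd dvdz_Fp // rmorphB /= rmorphXn subr_eq0 => /eqP.
  by apply/eqP; rewrite eqz_mod_dvd dvdz_Fp // rmorphB /= rmorphXn subr_eq0; apply/eqP.
case: asboolP => [[b /eqF ab]|nb]; split=> //; first by exists b%:~R.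
case=> y ay; case: nb; exists (y : nat)%:Z; apply/eqF.
by rewrite ay -pmulrn natr_Zp.
Qed.

(** A fraction with denominator prime to [q] lies in [q ^ 2] times the local ring
    exactly when [q ^ 2] divides its numerator. *)
Lemma Zloc_multiple q (H d : int) : prime q -> ~~ (q%:Z %| d)%Z ->
  (exists y : rat, Zloc q y /\ - H%:~R / d%:~R = q%:R ^+ 2 * y) <-> (q%:Z ^+ 2 %| H)%Z.
Proof.
move=> q_pr qd.
have nz b : ~~ (q%:Z %| b)%Z -> b%:~R != 0 :> rat.
  by rewrite intr_eq0; apply: contraNneq => ->; rewrite dvdz0.
have d0 := nz d qd; split.
  move=> [_ [[a [b [qb ->]]] Hab]]; have b0 := nz b qb.
  have Hb : H * b = q%:Z ^+ 2 * (- d * a).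
    apply: (@intr_inj rat); rewrite !rmorphM rmorphN /= -pmulrn.
    have -> : H%:~R = - (- H%:~R / d%:~R) * d%:~R :> rat by field.
    by rewrite Hab; field.
  have : (q%:Z ^+ 2 %| H * b)%Z by rewrite Hb dvdz_mulr.
  by rewrite Gauss_dvdzl // coprimezE abszX coprimeXl //= prime_coprime //.
move=> /dvdzP[h ->]; exists (- h%:~R / d%:~R); split.
  by exists (- h), d; rewrite rmorphN.
by rewrite rmorphM rmorphXn /= -pmulrn; field.
Qed.

Theorem theorem1p1 (q : nat) (q_prime : prime q) (q_ge3 : (3 <= q)%N)
  (m n : int) (p : nat)
  (p_def : p%:Z = \sum_(i < q) m ^+ i * n ^+ (q - 1 - i))
  (p_prime : prime p) (p_neq_q : p <> q) :
  power_residue_symbol q q%:Z p = 1 <->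
  exists y : rat, Zloc q y /\
    fhorner (neg_polylog rat (q - 1)) (n%:~R / m%:~R) = q%:R ^+ 2 * y.
Proof.
have pq : p != q by apply/eqP.
have q_gt0 := prime_gt0 q_prime.
have q_odd : odd q by case: (even_prime q_prime) => // q2; rewrite q2 in q_ge3.
have r_prim := ratio_primitive q_ge3 p_prime p_def q_prime pq.
have m_nr := m_eq_nr q_ge3 p_prime p_def.
have qmn := q_ndvd_sub q_ge3 p_prime p_def q_prime pq.
set r := _ / _ in r_prim m_nr.
have r0 : r != 0.
  apply/eqP => r0; have := prim_expr_order r_prim.
  by rewrite r0 expr0n eqn0Ngt q_gt0 => /esym/eqP; rewrite oner_eq0.
have mn : m != n by apply: contraNneq qmn => ->; rewrite subrr dvdz0.
have m0 : m != 0.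
  apply: contraNneq r0 => m0; have := p_ndvd_n q_ge3 p_prime p_def.
  by move: m_nr; rewrite m0 => /esym/eqP; rewrite mulf_eq0 => /orP[/eqP->|//]; rewrite eqxx.
have /dvdnP[f p_qf] : (q %| p.-1)%N.
  by rewrite (prim_order_dvd r_prim) Fp_expf_pred.
rewrite mulnC in p_qf.
have [ind [r_ind indM ind_onto indP]] := residue_index p_prime q_prime p_qf r_prim.
(* The inverse modulo [q], by Fermat. *)
pose inv t := (t ^ (q - 2))%N.
have invE t : (0 < t < q)%N -> (t * inv t)%N = 1%N %[mod q].
  move=> tq; rewrite -expnS; have -> : (q - 2).+1 = totient q.
    by rewrite totient_prime //; lia.
  by rewrite Euler_exp_totient // coprime_sym prime_coprime // gtnNdvd //; case/andP: tq.
have [e [k [N' [e2 G_factor]]]] := gauss_poly_factor p_prime q_prime q_odd p_qf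
  r_prim r_ind indM ind_onto mn m_nr p_def invE.
have [M [N G_lam]] := gauss_poly_lam p_prime q_prime q_odd indM ind_onto pq.
have crit := local_criterion q_prime q_odd p_prime pq qmn invE e2 G_factor G_lam.
have q0 : q%:R != 0 :> 'F_p by rewrite Fp_natr_eq0 // dvdn_prime2 // (negPf pq).
rewrite power_residue_symbolP // -pmulrn -(indP _ q0) -crit.
rewrite fhorner_neg_polylog // subn1 prednK // -[(m - n)%:~R ^+ q]rmorphXn.
apply: iff_sym; apply: Zloc_multiple => //.
by rewrite dvdzE abszX Euclid_dvdX // negb_and qmn.
Qed.
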